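(* Let $X$ be a Banach space. For every $1<p<\infty$, the Malliavin derivative $D$, defined on $X$-valued cylindrical functions (considered as a linear operator on those $F\in\mathscr{C}(\Omega;X)$ with $F\in L^p(\Omega;X)$ and $DF\in L^p(\Omega;\nu_p(E;X))$), is closable as an operator from $L^p(\Omega;X)$ into $L^p(\Omega;\nu_p(E;X))$.
   Context: Poisson random measure: $(\Omega,\mathcal{F},\mathbb{P})$ is a probability space, $(E,\mathcal{E})$ a measurable space, and $N$ is a Poisson random measure on $(E,\mathcal{E})$ with $\sigma$-finite intensity measure $\mu$, i.e. a map $N:\Omega\times\mathcal{E}\to\mathbb{N}\cup\{\infty\}$ such that $N(B)$ is a random variable for each $B\in\mathcal{E}$, $N(\omega,\cdot)$ is a measure for each $\omega$, $N(B)$ is Poisson distributed with parameter $\mu(B)$ ($N(B)=\infty$ a.s. if $\mu(B)=\infty$), and $N(B_1),\dots,N(B_n)$ are independent for pairwise disjoint $B_1,\dots,B_n$. Put $\mathcal{E}_\mu=\{B\in\mathcal{E}:\mu(B)<\infty\}$ and $\tilde N(B)=N(B)-\mu(B)$ for $B\in\mathcal{E}_\mu$. Poisson $p$-norm: for a simple function $f=\sum_{j=1}^m\mathbf 1_{B_j}\otimes x_j$ with $x_j\in X$ and pairwise disjoint $B_j\in\mathcal{E}_\mu$, let $\tilde N(f)=\sum_j\tilde N(B_j)x_j$ and $\|f\|_{\nu_p(E;X)}=(\mathbb{E}\|\tilde N(f)\|_X^p)^{1/p}$. $\nu_p(E;X)$ is the completion of the space of simple functions in this norm. Cylindrical functions: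 a (real) cylindrical function is a random variable $F=f(N(B_1),\dots,N(B_M))$ with $M\ge 1$, $f:\mathbb{N}^M\to\mathbb{R}$ ($0\in\mathbb{N}$) and $B_1,\dots,B_M\in\mathcal{E}_\mu$, which may always be taken pairwise disjoint. $\mathscr{C}(\Omega)$ is the vector space of these, and $\mathscr{C}(\Omega;X)=\mathscr{C}(\Omega)\otimes X$ consists of all $F=\sum_{i=1}^n F_i\otimes x_i$ with $F_i\in\mathscr{C}(\Omega)$, $x_i\in X$. Malliavin derivative: writing $F=\sum_{i=1}^n f_i(N(\mathbf{B}))\otimes x_i\in\mathscr{C}(\Omega;X)$ with $N(\mathbf{B})=(N(B_1),\dots,N(B_M))$, $B_1,\dots,B_M\in\mathcal{E}_\mu$ pairwise disjoint, and $\mathbf{e}_m$ the $m$-th unit vector of $\mathbb{R}^M$, $$DF=\sum_{i=1}^n\sum_{m=1}^M\big(f_i(N(\mathbf{B})+\mathbf{e}_m)-f_i(N(\mathbf{B}))\big)\otimes(\mathbf 1_{B_m}\otimes x_i),$$ a random variable with values in $L^2(E,\mu)\otimes X$, in fact in the $X$-valued simple functions on $E$; it does not depend on the representation. *)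

(* Defs.v *)
From HB Require Import structures.
From mathcomp Require Import all_boot all_order all_algebra.
From mathcomp Require Import all_classical all_reals all_analysis.
From mathcomp Require Import measurable_realfun.

Set Implicit Arguments.
Unset Strict Implicit.
Unset Printing Implicit Defensive.

Import Order.TTheory GRing.Theory Num.Theory.
Import numFieldNormedType.Exports.

Local Open Scope classical_set_scope.
Local Open Scope ring_scope.
Local Open Scope ereal_scope.

Section Bochner_Lp.
Context {d : measure_display} {Omega : measurableType d} {R : realType}.
Variable P : probability Omega R.

Section one_space.
Context {V : normedModType R}.

Definition bochner_simple (s : Omega -> V) : Prop :=
  finite_set (range s) /\ forall v, measurable (s @^-1` [set v]).

(* Limits are taken at every point: each a.e. class of an a.e. limit of simple
   functions has such a representative. *)
Definition strongly_measurable (F : Omega -> V) : Prop :=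
  exists s : nat -> Omega -> V,
    (forall n, bochner_simple (s n)) /\
    (forall w, s n w @[n --> \oo] --> F w).

Definition Lp_norm (p : R) (F : Omega -> V) : \bar R :=
  Lnorm P p%:E (fun w => (`|F w|%R)%:E).

Definition in_Lp (p : R) (F : Omega -> V) : Prop :=
  strongly_measurable F /\ Lp_norm p F < +oo.

Definition cvg_Lp (p : R) (Fn : nat -> Omega -> V) (F : Omega -> V) : Prop :=
  Lp_norm p (fun w => Fn n w - F w)%R @[n --> \oo] --> 0.

End one_space.

Context {V W : normedModType R}.

(* An operator from L^p(Omega; V) to L^p(Omega; W) is given by its graph, a
   relation T between representatives; the closure is the sequential one in
   L^p(Omega; V) x L^p(Omega; W). *)
Definition graph_closure (p : R) (T : (Omega -> V) -> (Omega -> W) -> Prop)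
    (F : Omega -> V) (G : Omega -> W) : Prop :=
  in_Lp p F /\ in_Lp p G /\
  exists (Fn : nat -> Omega -> V) (Gn : nat -> Omega -> W),
    (forall n, T (Fn n) (Gn n)) /\ cvg_Lp p Fn F /\ cvg_Lp p Gn G.

(* The closure of the graph is again the graph of a function on a.e. classes. *)
Definition closable (p : R) (T : (Omega -> V) -> (Omega -> W) -> Prop) : Prop :=
  forall F G1 G2, graph_closure p T F G1 -> graph_closure p T F G2 ->
    {ae P, forall w, G1 w = G2 w}.

End Bochner_Lp.

Section Poisson.
Context {d d' : measure_display} {Omega : measurableType d}
  {E : measurableType d'} {R : realType}.
Variables (P : probability Omega R) (mu : {sigma_finite_measure set E -> \bar R}).
Variable N : R.-ker Omega ~> E.

(* The kernel structure of N says that N w is a measure for every w, and that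
   w |-> N w B is measurable for every measurable B.  The Poisson weights are
   spelled out because the library's poisson_pmf is constantly 1 at rate 0. *)
Record poisson_random_measure : Prop := PoissonRandomMeasure {
  prm_nat : forall w B, measurable B ->
    N w B = +oo \/ exists n : nat, N w B = n%:R%:E ;
  prm_poisson : forall B (n : nat), measurable B -> mu B < +oo ->
    P [set w | N w B = n%:R%:E] =
      (expR (- fine (mu B)) * fine (mu B) ^+ n / n`!%:R)%R%:E ;
  prm_infty : forall B, measurable B -> mu B = +oo ->
    P [set w | N w B = +oo] = 1 ;
  prm_indep : forall (n : nat) (B : 'I_n -> set E) (A : 'I_n -> set (\bar R)),
    (forall i, measurable (B i)) -> trivIset setT B ->
    (forall i, measurable (A i)) ->
    P (\bigcap_(i in setT) [set w | A i (N w (B i))]) =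
      \prod_(i < n) P [set w | A i (N w (B i))]
}.

Definition finite_disjoint (M : nat) (B : 'I_M -> set E) : Prop :=
  (forall m, measurable (B m) /\ mu (B m) < +oo) /\ trivIset setT B.

(* For mu B < +oo, N w B = +oo only on a P-null set, where the value of both
   functions below is immaterial (it is taken from the convention fine +oo = 0). *)
Definition compensated (B : set E) (w : Omega) : R := fine (N w B) - fine (mu B).

Definition count (B : set E) (w : Omega) : nat := Num.truncn (fine (N w B)).

Definition counts (M : nat) (B : 'I_M -> set E) (w : Omega) :
  {ffun 'I_M -> nat} := [ffun m => count (B m) w].

Definition add_unit (M : nat) (k : {ffun 'I_M -> nat}) (m : 'I_M) :
  {ffun 'I_M -> nat} := [ffun l => (k l + (l == m))%N].

Section vector_valued.
Context {X : completeNormedModType R}.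

Definition step (M : nat) (B : 'I_M -> set E) (x : 'I_M -> X) : E -> X :=
  fun e => (\sum_(m < M) \1_(B m) e *: x m)%R.

Definition simple_functions : set (E -> X) :=
  [set f | exists (M : nat) (B : 'I_M -> set E) (x : 'I_M -> X),
     finite_disjoint B /\ f = step B x].

Definition compensated_integral (M : nat) (B : 'I_M -> set E) (x : 'I_M -> X)
    (w : Omega) : X :=
  (\sum_(m < M) compensated (B m) w *: x m)%R.

(* (V, iota) is the completion of the simple functions in the norm of
   nu_p(E; X), pinned down up to isometric isomorphism.  Since this norm
   vanishes exactly on the simple functions that are mu-a.e. zero, iota
   identifies simple functions that agree mu-a.e.  The values of iota outside
   simple_functions play no role. *)
Record nu_completion (p : R) (V : completeNormedModType R)
    (iota : (E -> X) -> V) : Prop := NuCompletion {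
  nu_linear : forall (a : R) (f g : E -> X),
    simple_functions f -> simple_functions g ->
    iota (a *: f + g)%R = (a *: iota f + iota g)%R ;
  nu_isometry : forall (M : nat) (B : 'I_M -> set E) (x : 'I_M -> X),
    finite_disjoint B ->
    (`|iota (step B x)|%R)%:E = Lp_norm P p (compensated_integral B x) ;
  nu_dense : dense (iota @` simple_functions)
}.

Definition cylindrical (n M : nat) (B : 'I_M -> set E)
    (f : 'I_n -> {ffun 'I_M -> nat} -> R) (x : 'I_n -> X) (w : Omega) : X :=
  (\sum_(i < n) f i (counts B w) *: x i)%R.

Definition malliavin (n M : nat) (B : 'I_M -> set E)
    (f : 'I_n -> {ffun 'I_M -> nat} -> R) (x : 'I_n -> X) (w : Omega) : E -> X :=
  fun e => (\sum_(i < n) \sum_(m < M)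
    (f i (add_unit (counts B w) m) - f i (counts B w)) *:
      (\1_(B m) e *: x i))%R.

(* The graph of D, over all disjoint representations of cylindrical functions;
   independence of the representation is not built in. *)
Definition malliavin_graph (p : R) (V : completeNormedModType R)
    (iota : (E -> X) -> V) (F : Omega -> X) (DF : Omega -> V) : Prop :=
  in_Lp P p F /\ in_Lp P p DF /\
  exists (n M : nat) (B : 'I_M -> set E)
    (f : 'I_n -> {ffun 'I_M -> nat} -> R) (x : 'I_n -> X),
    (0 < M)%N /\ finite_disjoint B /\
    {ae P, forall w, F w = cylindrical B f x w} /\
    {ae P, forall w, DF w = iota (malliavin B f x w)}.

End vector_valued.
End Poisson.

(* Main.v *)
Require Import Defs.
From HB Require Import structures.
From mathcomp Require Import all_boot all_order all_algebra.
From mathcomp Require Import all_classical all_reals all_analysis.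
From mathcomp Require Import measurable_realfun.
From mathcomp Require Import ring lra.
Import numFieldNormedType.Exports.

Local Open Scope classical_set_scope.
Local Open Scope ring_scope.

Set Implicit Arguments.
Unset Strict Implicit.
Unset Printing Implicit Defensive.

Import Order.TTheory GRing.Theory Num.Theory.

(** The proof compares derivatives on the events on which finitely many counts
    are prescribed.  Let [F] be a cylindrical function of the counts of a finite
    disjoint family [B].  On the event that these counts are equal to [k], its
    derivative is a fixed simple function on [B].  Let [H] be another cylindrical
    function; it may be written in terms of the counts kappa of a finer family [C]
    ([common_refinement], [represented_refines]).

    Averaging an [X]-valued simple function over the sets [B m] does not increase
    its norm ([iota_step_contraction]): by Mecke's formula ([mecke]), the
    compensated integral of the average is the conditional expectation, given the
    counts of [B], of the compensated integral, so that Jensen's inequality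
    applies ([norm_integral_le], [jensen_fibre_pow]).  The average leaves DF
    unchanged, hence |DF| is at most |DF - DH| plus the norm of the average of DH,
    and the latter is bounded by a combination of the values |H(kappa + e_c)| and
    |H(kappa)| ([increment_le]).  By Mecke's formula again, the integral of this
    combination over the event {counts of B = k} is at most K E|H|, where K depends
    on [B] and [k] only: removing a point of B_m leads from the counts k + e_m,
    with k_m + 1 points in B_m, to k ([integral_added_le]).  Therefore
      E(|DF|; counts = k) <= E(|DF - DH|; counts = k) + K E|H|
    ([derivative_fibre_le]).

    Let now [H n] be cylindrical with H_n -> 0 and DH_n -> G.  Taking F = H_n and
    H = H_j above, letting j tend to infinity, and then summing over k gives
    E|DH_n| <= E|DH_n - G|, hence DH_n -> 0 and G = 0 ([derivative_null]).  The
    theorem follows by linearity of the derivative ([ex_representedB]).  Since the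
    last estimates are in L^1, the exponent p only matters for the norm of
    nu_p(E; X). *)

(** * Discrete random variables *)

Section discrete_maps.
Context {d : measure_display} {Omega : measurableType d} {R : realType}.
Variable P : probability Omega R.
Context {T : countType}.
Local Open Scope ereal_scope.

(** A map into a countable type whose fibres are measurable, that is, a
    discrete random variable. *)
Definition discrete (tau : Omega -> T) := forall t, measurable (tau @^-1` [set t]).

Lemma discrete_preimage (tau : Omega -> T) (A : set T) :
  discrete tau -> measurable (tau @^-1` A).
Proof.
move=> dtau.
have -> : tau @^-1` A = \bigcup_(t in setT) (if t \in A then tau @^-1` [set t] else set0).
  apply/seteqP; split => [w Aw|w [t _]].
    by exists (tau w) => //; rewrite mem_set.
  by case: ifPn => // /set_mem At /= ->.
apply: countable_bigcupT_measurable => // t.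
by case: ifPn.
Qed.

Lemma discrete_measurable d' (S : measurableType d') (tau : Omega -> T)
    (g : T -> S) : discrete tau -> measurable_fun setT (g \o tau).
Proof.
by move=> dtau _ Y mY; rewrite setTI comp_preimage; exact: discrete_preimage.
Qed.

Lemma discrete_comp (T' : countType) (tau : Omega -> T) (g : T -> T') :
  discrete tau -> forall t, measurable ((g \o tau) @^-1` [set t]).
Proof. by move=> dtau t; rewrite comp_preimage; exact: discrete_preimage. Qed.

Lemma integral_fibres (tau : Omega -> T) (f : Omega -> \bar R) :
  discrete tau -> measurable_fun setT f -> (forall w, 0 <= f w) ->
  \int[P]_w f w = \esum_(t in setT) \int[P]_(w in tau @^-1` [set t]) f w.
Proof.
move=> dtau mf f0.
pose F (n : nat) := tau @^-1` [set t | pickle t = n].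
have mF n : measurable (F n) by exact: discrete_preimage.
have UF : \bigcup_n F n = setT.
  by apply/seteqP; split => // w _; exists (pickle (tau w)).
have tF : trivIset setT F.
  by move=> i j _ _ [w [/= <- <-]].
rewrite -{1}UF ge0_integral_bigcup//; last by rewrite UF.
rewrite nneseries_esumT; last by move=> n; apply: integral_ge0 => w _; exact: f0.
transitivity (\esum_(n in pickle @` [set: T]) \int[P]_(w in F n) f w).
  rewrite [RHS]esum_mkcond; apply: eq_esum => n _.
  case: ifPn => // nT; rewrite (_ : F n = set0) ?integral_set0//.
  rewrite -subset0 => w /= Fn; move/negP: nT; apply.
  by rewrite inE; exists (tau w).
rewrite esum_image; last by move=> x y _ _; exact: (pcan_inj pickleK).
apply: eq_esum => t _; congr (integral _ _ _).
apply/seteqP; split => w /= [h]; last by rewrite /F /= h.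
exact: (pcan_inj pickleK).
Qed.

Lemma integral_discrete (tau : Omega -> T) (g : T -> \bar R) :
  discrete tau -> (forall t, 0 <= g t) ->
  \int[P]_w g (tau w) = \esum_(t in setT) (g t * P (tau @^-1` [set t])).
Proof.
move=> dtau g0; rewrite (@integral_fibres tau)//; last exact: discrete_measurable.
apply: eq_esum => t _; rewrite -integral_cst//.
by apply: eq_integral => w /set_mem /= ->.
Qed.

Lemma integral_fibre_if (tau : Omega -> T) (f : Omega -> \bar R) (t : T) :
  \int[P]_(w in tau @^-1` [set t]) f w =
  \int[P]_w (if tau w == t then f w else 0).
Proof.
rewrite integral_mkcond; apply: eq_integral => w _.
rewrite patchE; case: ifPn.
  by rewrite inE => /= ->; rewrite eqxx.
by case: eqP => // e /negP; rewrite inE.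
Qed.

(** An inequality between integrals may be checked on the fibres of a discrete
    random variable. *)
Lemma le_integral_fibres (tau : Omega -> T) (f g : Omega -> \bar R) :
  discrete tau -> measurable_fun setT f -> measurable_fun setT g ->
  (forall w, 0 <= f w) -> (forall w, 0 <= g w) ->
  (forall t, \int[P]_w (if tau w == t then f w else 0) <=
             \int[P]_w (if tau w == t then g w else 0)) ->
  \int[P]_w f w <= \int[P]_w g w.
Proof.
move=> dtau mf mg f0 g0 fg.
rewrite (integral_fibres dtau mf f0) (integral_fibres dtau mg g0).
by apply: le_esum => t _; rewrite !integral_fibre_if.
Qed.

Lemma measurable_fibre_if (tau : Omega -> T) (f : Omega -> \bar R) (t : T) :
  discrete tau -> measurable_fun setT f ->
  measurable_fun setT (fun w => if tau w == t then f w else 0).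
Proof.
move=> dtau mf; apply: measurable_fun_ifT => //.
exact: (@discrete_measurable _ _ tau (fun x => x == t)).
Qed.

End discrete_maps.

(** * Jensen's inequality *)

Section Jensen.
Context {d : measure_display} {Omega : measurableType d} {R : realType}.
Variable P : probability Omega R.
Context {T : countType} {X : normedModType R}.

Lemma integral_fibre_cst (tau : Omega -> T) (g : T -> \bar R) (t : T) :
  discrete tau ->
  (\int[P]_w (if tau w == t then g (tau w) else 0) =
   g t * P (tau @^-1` [set t]))%E.
Proof.
move=> dtau; rewrite -(@integral_fibre_if _ _ _ _ _ _ (g \o tau)) -integral_cst//.
by apply: eq_integral => w /set_mem /= ->.
Qed.

Variables (L : nat) (tau : Omega -> T) (zeta : 'I_L -> T -> R) (x : 'I_L -> X).
Hypothesis dtau : discrete tau.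
Hypothesis izeta : forall c, P.-integrable setT (fun w => (zeta c (tau w))%:E).

(* the restriction of f(tau) to the event that tau is among the first n values *)
Let below (n : nat) (f : T -> R) (w : Omega) : \bar R :=
  (if (pickle (tau w) < n)%N then (f (tau w))%:E else 0)%E.

Let mbelow n f : measurable_fun setT (below n f).
Proof.
exact: (@discrete_measurable _ _ _ _ _ tau
  (fun t => if (pickle t < n)%N then (f t)%:E else 0%E)).
Qed.

Let below_le n f w : (`|below n f w| <= `|(f (tau w))%:E|)%E.
Proof. by rewrite /below; case: ifPn => // _; rewrite abse0. Qed.

Let ibelow n c : P.-integrable setT (below n (zeta c)).
Proof.
by apply: le_integrable (izeta c) => //.
Qed.

Let belowS n f w : below n.+1 f w =
  (below n f w + (if pickle (tau w) == n then (f (tau w))%:E else 0))%E.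
Proof.
rewrite /below ltnS leq_eqVlt.
by case: eqP => [->|_] /=; rewrite ?ltnn ?add0e ?adde0.
Qed.

Let norm_below n :
  (`|\sum_(c < L) fine (\int[P]_w below n (zeta c) w)%E *: x c|%:E <=
   \int[P]_w below n (fun t => `|\sum_(c < L) zeta c t *: x c|%R) w)%E.
Proof.
elim: n => [|n IHn].
  have Z f : (\int[P]_w below 0%N f w = 0)%E.
    by under eq_integral do rewrite /below ltn0; rewrite integral0.
  rewrite big1 ?normr0; last by move=> c _; rewrite Z scale0r.
  by apply: integral_ge0 => w _; rewrite /below ltn0.
set h := fun t => `|\sum_(c < L) zeta c t *: x c|%R in IHn *.
have [[t tn]|tn] := pselect (exists t : T, pickle t = n); last first.
  have E f w : below n.+1 f w = below n f w.
    rewrite belowS; case: eqP; rewrite ?adde0// => e.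
    by exfalso; apply: tn; exists (tau w).
  under eq_bigr do under eq_integral do rewrite E.
  by under eq_integral do rewrite E.
have E f w : below n.+1 f w =
    (below n f w + (if tau w == t then (f (tau w))%:E else 0))%E.
  rewrite belowS -tn; congr (_ + _)%E.
  by rewrite (inj_eq (pcan_inj pickleK)).
have meq (f : T -> R) :
    measurable_fun setT (fun w => (if tau w == t then (f (tau w))%:E else 0)%E).
  exact: (@discrete_measurable _ _ _ _ _ tau
    (fun s => if s == t then (f s)%:E else 0%E)).
have Eq (f : T -> R) : (\int[P]_w (if tau w == t then (f (tau w))%:E else 0) =
     (f t)%:E * P (tau @^-1` [set t]))%E.
  exact: (integral_fibre_cst (fun s => (f s)%:E)).
have Pfin : P (tau @^-1` [set t]) \is a fin_num by exact: fin_num_measure.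
have I c : fine (\int[P]_w below n.+1 (zeta c) w)%E =
    (fine (\int[P]_w below n (zeta c) w)%E + zeta c t * fine (P (tau @^-1` [set t])))%R.
  under eq_integral do rewrite E.
  rewrite integralD//; last first.
    apply: le_integrable (izeta c) => // w _.
    by case: ifPn => // _; rewrite abse0.
  by rewrite Eq fineD ?fineM// ?fin_numM//; exact: integrable_fin_num.
under eq_bigr do rewrite I scalerDl mulrC -scalerA.
rewrite big_split/= -scaler_sumr.
under eq_integral do rewrite E.
rewrite ge0_integralD//=; last 2 first.
- by move=> w _; rewrite /below; case: ifPn; rewrite // lee_fin normr_ge0.
- by move=> w _; case: ifPn; rewrite // lee_fin normr_ge0.
rewrite Eq; apply: le_trans (leeD IHn (lexx _)).
rewrite -[P _ in leRHS]fineK// -EFinM -EFinD lee_fin (le_trans (ler_normD _ _))//.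
by rewrite lerD2l normrZ mulrC ger0_norm// fine_ge0.
Qed.

(** Jensen's inequality for the norm of a random vector in the span of finitely
    many vectors, whose coordinates are integrable and discrete. *)
Lemma norm_integral_le :
  (`|\sum_(c < L) fine (\int[P]_w (zeta c (tau w))%:E)%E *: x c|%:E <=
   \int[P]_w `|\sum_(c < L) zeta c (tau w) *: x c|%:E)%E.
Proof.
set h := fun t => `|\sum_(c < L) zeta c t *: x c|%R.
have cvgc c : fine (\int[P]_w below n (zeta c) w)%E @[n --> \oo] -->
    fine (\int[P]_w (zeta c (tau w))%:E)%E.
  apply: fine_cvg; rewrite fineK; last exact: integrable_fin_num.
  apply: (@dominated_cvg _ _ _ P setT measurableT _ _
    (fun w => `|(zeta c (tau w))%:E|%E)) => //.
  - move=> w _; apply: cvg_near_cst; near=> n.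
    rewrite /below ifT//; near: n; exact: nbhs_infty_gt.
  - exact: integrable_abse.
have cvgn : `|\sum_(c < L) fine (\int[P]_w below n (zeta c) w)%E *: x c|%:E
    @[n --> \oo] --> `|\sum_(c < L) fine (\int[P]_w (zeta c (tau w))%:E)%E *: x c|%:E.
  apply: cvg_EFin; first exact: nearW.
  apply: cvg_norm; apply: cvg_big => [|c _]; first exact: add_continuous.
  exact: cvgZr_tmp.
rewrite -(cvg_lim _ cvgn)//; apply: lime_le; first by apply: cvgP cvgn.
apply: nearW => n; apply: le_trans (norm_below n) _; apply: ge0_le_integral => //.
- by move=> w _; rewrite /below; case: ifPn; rewrite // lee_fin.
- exact: (@discrete_measurable _ _ _ _ _ tau
    (fun t => `|\sum_(c < L) zeta c t *: x c|%:E)).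
- by move=> w _; rewrite /below; case: ifPn; rewrite // lee_fin.
Unshelve. all: by end_near.
Qed.

End Jensen.
(** * Counts of a Poisson random measure *)

Section Poisson_counts.
Context {d d' : measure_display} {Omega : measurableType d}
  {E : measurableType d'} {R : realType}.
Variables (P : probability Omega R) (mu : {sigma_finite_measure set E -> \bar R}).
Variable N : R.-ker Omega ~> E.
Hypothesis prmN : poisson_random_measure P mu N.

Lemma measurable_prm (B : set E) (Y : set (\bar R)) :
  measurable B -> measurable Y -> measurable [set w | Y (N w B)].
Proof.
by move=> mB mY; rewrite -[X in measurable X]setTI; exact: measurable_kernel.
Qed.

Lemma fine_count (B : set E) (w : Omega) :
  measurable B -> fine (N w B) = (Defs.count N B w)%:R.
Proof.
move=> mB; rewrite /Defs.count.
case: (prm_nat prmN w mB) => [->|[n ->]] /=; first by rewrite Num.Theory.truncn0.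
by rewrite Num.Theory.natrK.
Qed.

Lemma prm_count (B : set E) (w : Omega) :
  measurable B -> N w B != +oo%E -> N w B = (Defs.count N B w)%:R%:E.
Proof.
move=> mB NB; rewrite -fine_count// fineK//.
by case: (prm_nat prmN w mB) NB => [->|[n ->]].
Qed.

Lemma count_preimage (B : set E) (n : nat) : measurable B ->
  Defs.count N B @^-1` [set n] = [set w | N w B = n%:R%:E] `|`
    (if n == 0%N then [set w | N w B = +oo%E] else set0).
Proof.
move=> mB; apply/seteqP; split=> w /=.
  move=> <-; case: (eqVneq (N w B) +oo%E) => [Ny|Ny].
    by right; rewrite /Defs.count Ny /= Num.Theory.truncn0 eqxx.
  by left; exact: prm_count.
case=> [Nn|].
  by rewrite /Defs.count Nn /= Num.Theory.natrK.
by case: eqP => // -> /= Ny; rewrite /Defs.count Ny /= Num.Theory.truncn0.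
Qed.

Lemma discrete_counts (M : nat) (B : 'I_M -> set E) :
  (forall m, measurable (B m)) -> discrete (counts N B).
Proof.
move=> mB k.
have -> : counts N B @^-1` [set k] =
    \bigcap_(m in [set: 'I_M]) (Defs.count N (B m) @^-1` [set k m]).
  apply/seteqP; split => [w <- m _|w kw] /=; first by rewrite ffunE.
  by apply/ffunP => m; rewrite ffunE; exact: kw.
apply: fin_bigcap_measurable => // m _; rewrite count_preimage//.
apply: measurableU; first exact: (@measurable_prm _ [set (k m)%:R%:E]).
by case: ifP => // _; exact: (@measurable_prm _ [set +oo%E]).
Qed.

(** The Poisson weights sum to one, hence a set of finite intensity almost
    surely contains finitely many points. *)
Lemma prm_pinfty_null (B : set E) : measurable B -> (mu B < +oo)%E ->
  P [set w | N w B = +oo%E] = 0%E.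
Proof.
move=> mB muB.
set r := fine (mu B); have r0 : 0 <= r by exact: fine_ge0.
pose F (n : nat) := [set w | N w B = n%:R%:E].
have mF n : measurable (F n) by exact: (@measurable_prm _ [set n%:R%:E]).
have tF : trivIset setT F.
  move=> i j _ _ [w []]; rewrite /F /= => -> [] /eqP.
  by rewrite eqr_nat => /eqP.
have -> : [set w | N w B = +oo%E] = ~` \bigcup_n F n.
  apply/seteqP; split => w /=; first by move=> Ny [n _]; rewrite /F /= Ny.
  move=> Fw; case: (prm_nat prmN w mB) => // -[n Nn].
  by exfalso; apply: Fw; exists n.
rewrite probability_setC; last exact: bigcup_measurable.
suff -> : P (\bigcup_n F n) = 1%E by rewrite subee.
rewrite measure_semi_bigcup//; last exact: bigcup_measurable.
have PF n : P (F n) = ((expR (- r))%:E * (r ^+ n / n`!%:R)%:E)%E.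
  by rewrite -EFinM mulrA; exact: (prm_poisson prmN).
transitivity (\sum_(n <oo) ((expR (- r))%:E * (r ^+ n / n`!%:R)%:E))%E.
  by apply: eq_eseriesr => n _; exact: PF.
rewrite nneseriesZl/=; last first.
  by move=> n _; rewrite lee_fin divr_ge0// exprn_ge0.
rewrite -/r (_ : (\sum_(n <oo) (r ^+ n / n`!%:R)%:E = (expR r)%:E)%E).
  by rewrite -EFinM expRN mulVf ?gt_eqF ?expR_gt0.
rewrite /expR -EFin_lim; last exact: is_cvg_series_exp_coeff.
by apply/congr_lim/funext => n/=; rewrite /series/= -sumEFin.
Qed.

Section disjoint_family.
Variables (L : nat) (C : 'I_L -> set E).
Hypothesis hC : finite_disjoint mu C.

Let kappa := counts N C.
Let r c := fine (mu (C c)).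

Let mC c : measurable (C c). Proof. exact: (hC.1 c).1. Qed.
Let Coo c : (mu (C c) < +oo)%E. Proof. exact: (hC.1 c).2. Qed.

(** The event that all the sets of the family contain finitely many points. *)
Definition all_finite : set Omega := [set w | forall c, N w (C c) != +oo%E].

Lemma ae_all_finite : {ae P, forall w, all_finite w}.
Proof.
have H c : {ae P, forall w, N w (C c) != +oo%E}.
  exists [set w | N w (C c) = +oo%E]; split.
  - exact: (@measurable_prm _ [set +oo%E]).
  - exact: prm_pinfty_null.
  - by move=> w /= /negP; rewrite negbK => /eqP.
exact: (@filter_forall _ _ _ (almost_everywhere P) _ H).
Qed.

Lemma prob_counts (a : {ffun 'I_L -> nat}) :
  P (kappa @^-1` [set a]) =
  (\prod_(c < L) (expR (- r c) * r c ^+ a c / (a c)`!%:R))%:E.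
Proof.
pose A : set Omega := \bigcap_(c in [set: 'I_L]) [set w | [set (a c)%:R%:E] (N w (C c))].
have mA : measurable A.
  by apply: fin_bigcap_measurable => // c _; exact: (@measurable_prm _ [set (a c)%:R%:E]).
have mk : measurable (kappa @^-1` [set a]) by exact: discrete_counts.
have AK : A `<=` kappa @^-1` [set a].
  move=> w Aw; apply/ffunP => c; rewrite ffunE.
  by rewrite /Defs.count (Aw c)//= Num.Theory.natrK.
transitivity (P A).
  (* a count is zero by convention when there are infinitely many points, so that
     the two events may differ on the null set Z *)
  have [Z [mZ PZ ZP]] := ae_all_finite.
  apply/eqP; rewrite eq_le; apply/andP; split; last by apply: le_measure; rewrite ?inE.
  apply: (@le_trans _ _ (P (A `|` Z))).
    apply: le_measure; rewrite ?inE//; first exact: measurableU.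
    move=> w /= kw; case: (pselect (all_finite w)) => [fw|nfw]; last first.
      by right; apply: ZP.
    left => c _ /=; rewrite (prm_count (mC c) (fw c)).
    by rewrite -kw ffunE.
  by rewrite (le_trans (measureU2 _ mA mZ))// [X in (_ + X)%E]PZ adde0.
transitivity (\prod_(c < L) P [set w | [set (a c)%:R%:E] (N w (C c))])%E.
  exact: (prm_indep prmN (A := fun c => [set (a c)%:R%:E]) mC hC.2).
rewrite -prodEFin; apply: eq_bigr => c _; exact: (prm_poisson prmN).
Qed.

(** Mecke's formula: adding a point to a Poisson count amounts to weighting by
    that count. *)
Lemma mecke (c : 'I_L) (g : {ffun 'I_L -> nat} -> \bar R) :
  (forall a, 0 <= g a)%E ->
  ((r c)%:E * \int[P]_w g (add_unit (kappa w) c) =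
   \int[P]_w ((kappa w c)%:R%:E * g (kappa w)))%E.
Proof.
move=> g0.
have dk : discrete kappa by exact: discrete_counts.
have r0 : 0 <= r c by exact: fine_ge0.
rewrite -ge0_integralZl//; last first.
  exact: (@discrete_measurable _ _ _ _ _ kappa (fun a => g (add_unit a c))).
rewrite (@integral_discrete _ _ _ _ _ kappa
  (fun a => (r c)%:E * g (add_unit a c))%E)//; last first.
  by move=> a; rewrite mule_ge0.
rewrite (@integral_discrete _ _ _ _ _ kappa (fun a => (a c)%:R%:E * g a)%E)//; last first.
  by move=> a; rewrite mule_ge0// lee_fin.
pose G (b : {ffun 'I_L -> nat}) := ((b c)%:R%:E * g b * P (kappa @^-1` [set b]))%E.
transitivity (\esum_(a in [set: {ffun 'I_L -> nat}]) G (add_unit a c)).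
  apply: eq_esum => a _; rewrite /G !prob_counts.
  rewrite muleAC [in RHS]muleAC -!EFinM; congr (_ * _)%E; congr EFin.
  rewrite (bigD1 c)//= [in RHS](bigD1 c)//=.
  rewrite (eq_bigr (fun l => expR (- r l) * r l ^+ (add_unit a c) l /
    ((add_unit a c) l)`!%:R)); last first.
    by move=> l /negbTE lc; rewrite ffunE lc addn0.
  rewrite !mulrA; congr (_ * _).
  rewrite ffunE eqxx addn1 factS natrM exprS invfM.
  have : (a c).+1%:R != 0 :> R by rewrite pnatr_eq0.
  by move=> ?; field; rewrite (pnatr_eq0 R (a c)`!) -lt0n fact_gt0/=.
rewrite -(esum_image setT (fun a => add_unit a c) G); last first.
  move=> a b _ _ /ffunP ab; apply/ffunP => l.
  by have := ab l; rewrite !ffunE => /addIn.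
rewrite esum_mkcond; apply: eq_esum => b _; case: ifPn => // bT.
suff -> : b c = 0%N by rewrite !mul0e.
apply/eqP/negPn/negP => bc; move/negP: bT; apply; rewrite inE.
exists [ffun l => (b l - (l == c))%N] => //.
apply/ffunP => l; rewrite !ffunE; case: eqP => [->|_]; last by rewrite subn0 addn0.
by rewrite subnK// lt0n.
Qed.

End disjoint_family.
End Poisson_counts.
(** * Refinement of finite families of sets *)

Section refinement.
Context {d' : measure_display} {E : measurableType d'} {R : realType}.

(** The family [C] refines the family [B] along [sigma] when each [B m] is the
    union of the [C c] with [sigma c = Some m]; the sets [C c] with
    [sigma c = None] lie outside of the union of [B]. *)
Definition refines (M L : nat) (C : 'I_L -> set E) (sigma : 'I_L -> option 'I_M)
    (B : 'I_M -> set E) : Prop :=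
  forall m, B m = \big[setU/set0]_(c < L | sigma c == Some m) C c.

(** The counts of the coarse family as a function of the counts of the fine one. *)
Definition push (M L : nat) (sigma : 'I_L -> option 'I_M)
    (a : {ffun 'I_L -> nat}) : {ffun 'I_M -> nat} :=
  [ffun m => \sum_(c < L | sigma c == Some m) a c].

(** The function on the fine family that is constant on the classes of [sigma],
    with the values [y], and zero on the sets that belong to no class. *)
Definition pull (T : zmodType) (M L : nat) (sigma : 'I_L -> option 'I_M)
  (y : 'I_M -> T) (c : 'I_L) : T := if sigma c is Some m then y m else 0.

Lemma sum_classes (T : nmodType) (M L : nat) (sigma : 'I_L -> option 'I_M)
    (F : 'I_L -> T) : (forall c, sigma c = None -> F c = 0) ->
  \sum_(c < L) F c = \sum_(m < M) \sum_(c < L | sigma c == Some m) F c.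
Proof.
move=> F0; rewrite (exchange_big_dep predT)//=; apply: eq_bigr => c _.
case sc : (sigma c) => [m|]; last by rewrite big_pred0 ?F0.
by rewrite (big_pred1 m)// => m'; rewrite /= eq_sym.
Qed.

Lemma push_add_unit (M L : nat) (sigma : 'I_L -> option 'I_M)
    (a : {ffun 'I_L -> nat}) (c : 'I_L) :
  push sigma (add_unit a c) =
  if sigma c is Some m then add_unit (push sigma a) m else push sigma a.
Proof.
have E1 m : push sigma (add_unit a c) m = (push sigma a m + (sigma c == Some m))%N.
  rewrite !ffunE (eq_bigr (fun l => a l + (l == c))%N); last by move=> l _; rewrite ffunE.
  rewrite big_split/=; congr (_ + _)%N.
  rewrite big_mkcond (bigD1 c)//= eqxx big1 ?addn0; first by case: ifP.
  by move=> l /negbTE ->; case: ifP.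
case sc : (sigma c) => [m|]; apply/ffunP => l; rewrite E1 sc; last by rewrite addn0.
by rewrite [RHS]ffunE [l == m]eq_sym.
Qed.

Lemma bigsetUP (L : nat) (C : 'I_L -> set E) (Q : pred 'I_L) (e : E) :
  (\big[setU/set0]_(c < L | Q c) C c) e <-> exists2 c, Q c & C c e.
Proof.
split; last by move=> [c Qc Ce]; rewrite (bigD1 c)//=; left.
elim/big_ind: _ => [//|A B HA HB [/HA|/HB]//|c Qc Ce].
by exists c.
Qed.

Lemma measure_refines (m0 : {measure set E -> \bar R}) (M L : nat)
    (C : 'I_L -> set E) (sigma : 'I_L -> option 'I_M) (B : 'I_M -> set E) (m : 'I_M) :
  (forall c, measurable (C c)) -> trivIset setT C -> refines C sigma B ->
  (m0 (B m) = \sum_(c < L | sigma c == Some m) m0 (C c))%E.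
Proof. by move=> mC tC CB; rewrite CB measure_bigsetU_ord. Qed.

Lemma indic_refines (M L : nat) (C : 'I_L -> set E) (sigma : 'I_L -> option 'I_M)
    (B : 'I_M -> set E) (m : 'I_M) (e : E) : (forall c, measurable (C c)) ->
  trivIset setT C -> refines C sigma B ->
  \1_(B m) e = \sum_(c < L | sigma c == Some m) \1_(C c) e :> R.
Proof.
move=> mC tC CB; apply/EFin_inj; rewrite -sumEFin.
exact: (measure_refines (dirac e) m mC tC CB).
Qed.

Lemma step_refines (X : completeNormedModType R) (M L : nat) (C : 'I_L -> set E)
    (sigma : 'I_L -> option 'I_M) (B : 'I_M -> set E) (y : 'I_M -> X) :
  (forall c, measurable (C c)) -> trivIset setT C -> refines C sigma B ->
  step B y = step C (pull sigma y).
Proof.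
move=> mC tC CB; apply/funext => e.
rewrite /step [RHS](sum_classes (sigma := sigma)); last first.
  by move=> c sc; rewrite /pull sc scaler0.
apply: eq_bigr => m _; rewrite (indic_refines _ _ mC tC CB) scaler_suml.
by apply: eq_bigr => c /eqP sc; rewrite /pull sc.
Qed.

(** The partition generated by two finite disjoint families. *)
Lemma common_refinement (mu : {sigma_finite_measure set E -> \bar R}) (M M' : nat)
    (B : 'I_M -> set E) (B' : 'I_M' -> set E) :
  finite_disjoint mu B -> finite_disjoint mu B' ->
  exists (L : nat) (C : 'I_L -> set E) (sigma : 'I_L -> option 'I_M)
    (sigma' : 'I_L -> option 'I_M'),
  [/\ finite_disjoint mu C, refines C sigma B & refines C sigma' B'].
Proof.
move=> [hB tB] [hB' tB'].
pose part (K : nat) (A : 'I_K -> set E) (x : option 'I_K) : set E :=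
  if x is Some k then A k else ~` \big[setU/set0]_(k < K) A k.
have mpart K (A : 'I_K -> set E) x :
    (forall k, measurable (A k)) -> measurable (part K A x).
  move=> mA; case: x => [k|] //=; apply: measurableC.
  by apply: bigsetU_measurable => k _.
have partT K (A : 'I_K -> set E) e : exists x, part K A x e.
  case: (pselect ((\big[setU/set0]_(k < K) A k) e)) => [/bigsetUP[k _ Ak]|Ae].
    by exists (Some k).
  by exists None.
have part1 K (A : 'I_K -> set E) x y e : trivIset setT A ->
    part K A x e -> part K A y e -> x = y.
  move=> tA; case: x y => [k|] [l|] //= Ak Al.
  - by congr Some; apply: (tA k l I I); exists e.
  - by exfalso; apply: Al; apply/bigsetUP; exists k.
  - by exfalso; apply: Ak; apply/bigsetUP; exists l.
(* the complement of both unions may have infinite measure; it is not needed, and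
   it is replaced by the empty set *)
pose T := (option 'I_M * option 'I_M')%type.
pose D (z : T) : set E :=
  if z == (None, None) then set0 else part _ B z.1 `&` part _ B' z.2.
have Dsub z e : D z e -> part _ B z.1 e /\ part _ B' z.2 e.
  by rewrite /D; case: ifP.
have mD z : measurable (D z).
  rewrite /D; case: ifP => // _; apply: measurableI; apply: mpart => k.
    exact: (hB k).1.
  exact: (hB' k).1.
exists #|{: T}|, (fun c => D (enum_val c)), (fun c => (enum_val c).1),
  (fun c => (enum_val c).2); split.
- split; last first.
    move=> c c' _ _ [e [/Dsub[e1 e2] /Dsub[e1' e2']]]; apply: enum_val_inj.
    move: e1 e2 e1' e2'; case: (enum_val c) => x y; case: (enum_val c') => x' y' /= *.
    by congr pair; [apply: (part1 _ B) | apply: (part1 _ B')]; eassumption.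
  move=> c; split; first exact: mD.
  case: (enum_val c) => -[m|] [m'|]; last by rewrite /D eqxx measure0.
  + apply: le_lt_trans (hB m).2; apply: le_measure; rewrite ?inE//.
      exact: (hB m).1.
    by move=> e /Dsub[].
  + apply: le_lt_trans (hB m).2; apply: le_measure; rewrite ?inE//.
      exact: (hB m).1.
    by move=> e /Dsub[].
  + apply: le_lt_trans (hB' m').2; apply: le_measure; rewrite ?inE//.
      exact: (hB' m').1.
    by move=> e /Dsub[].
- move=> m; apply/seteqP; split => e.
    move=> Be; have [y ye] := partT _ B' e; apply/bigsetUP.
    exists (enum_rank ((Some m, y) : T)); rewrite enum_rankK//.
  by move=> /bigsetUP[c /eqP cm /Dsub[]]; rewrite cm.
- move=> m; apply/seteqP; split => e.
    move=> Be; have [y ye] := partT _ B e; apply/bigsetUP.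
    exists (enum_rank ((y, Some m) : T)); rewrite enum_rankK// /D.
    by case: eqP => // -[].
  by move=> /bigsetUP[c /eqP cm /Dsub[]]; rewrite cm.
Qed.

End refinement.
(** * Averaging decreases the Poisson norm *)

Section powR_tangent.
Context {R : realType}.

(** The graph of t |-> t^p lies above its tangent at s. *)
Lemma powR_tangent (p s t : R) : 1 < p -> 0 <= s -> 0 <= t ->
  p * s `^ (p - 1) * t <= t `^ p + (p - 1) * s `^ p.
Proof.
move=> p1 s0 t0.
have p0 : 0 < p by lra.
have q0 : 0 < p - 1 by lra.
have pq : p^-1 + (p / (p - 1))^-1 = 1.
  by field; rewrite !gt_eqF.
have := conjugate_powR t0 (powR_ge0 s (p - 1)) p0 (divr_gt0 p0 q0) pq.
rewrite -powRrM mulrCA divff ?gt_eqF// mulr1 -(ler_pM2l p0).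
rewrite mulrDr.
have -> : p * (t `^ p / p) = t `^ p by field; rewrite gt_eqF.
have -> : p * (s `^ p / (p / (p - 1))) = (p - 1) * s `^ p.
  by field; rewrite !gt_eqF.
by rewrite [t * _]mulrC mulrA.
Qed.

Lemma powR_pred (p s : R) : 1 < p -> 0 <= s -> s `^ (p - 1) * s = s `^ p.
Proof.
move=> p1 s0; have [->|sn0] := eqVneq s 0; first by rewrite mulr0 powR0// gt_eqF//; lra.
rewrite -[X in _ * X]powRr1// -powRD ?subrK//.
by rewrite sn0 implybT.
Qed.

End powR_tangent.

Section nu_norm.
Context {d d' : measure_display} {Omega : measurableType d}
  {E : measurableType d'} {R : realType}.
Variables (P : probability Omega R) (mu : {sigma_finite_measure set E -> \bar R}).
Variable N : R.-ker Omega ~> E.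
Hypothesis prmN : poisson_random_measure P mu N.
Context {X : completeNormedModType R}.

Lemma Lp_norm_powE (p : R) (F : Omega -> X) :
  Lp_norm P p F = ((\int[P]_w (`|F w| `^ p)%:E) `^ p^-1)%E.
Proof.
rewrite /Lp_norm Lnorm.unlock; congr (_ `^ _)%E.
by apply: eq_integral => w _; rewrite /= normr_id.
Qed.

Lemma le_Lp_norm_pow (p : R) (F G : Omega -> X) : 0 < p ->
  (\int[P]_w (`|F w| `^ p)%:E <= \int[P]_w (`|G w| `^ p)%:E)%E ->
  (Lp_norm P p F <= Lp_norm P p G)%E.
Proof.
move=> p0 FG; rewrite !Lp_norm_powE; apply: gt0_ler_poweR.
- by rewrite invr_ge0 ltW.
- by rewrite in_itv/= leey andbT integral_ge0// => w _; rewrite lee_fin powR_ge0.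
- by rewrite in_itv/= leey andbT integral_ge0// => w _; rewrite lee_fin powR_ge0.
- exact: FG.
Qed.

Section classes.
Variables (M L : nat) (C : 'I_L -> set E) (B : 'I_M -> set E).
Variable sigma : 'I_L -> option 'I_M.
Hypotheses (hC : finite_disjoint mu C) (hB : finite_disjoint mu B).
Hypothesis CB : refines C sigma B.

Let r c := fine (mu (C c)).
Let s m := fine (mu (B m)).
Let kappa := counts N C.
Let mC c : measurable (C c). Proof. exact: (hC.1 c).1. Qed.
Let mB m : measurable (B m). Proof. exact: (hB.1 m).1. Qed.
Let r0 c : 0 <= r c. Proof. by rewrite fine_ge0. Qed.
Let dk : discrete kappa. Proof. exact: (discrete_counts prmN). Qed.

Lemma counts_refines w : all_finite N C w -> counts N B w = push sigma (kappa w).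
Proof.
move=> fw; apply/ffunP => m; rewrite !ffunE; apply/eqP.
rewrite -(eqr_nat R) -(fine_count prmN _ (mB m)) natr_sum.
rewrite (measure_refines (N w) m mC hC.2 CB).
rewrite (eq_bigr (fun c => (kappa w c)%:R%:E)); last first.
  by move=> c _; rewrite ffunE; apply: (prm_count prmN) => //; exact: fw.
by rewrite sumEFin.
Qed.

Lemma fine_measure_refines m : s m = \sum_(c < L | sigma c == Some m) r c.
Proof.
rewrite /s (measure_refines mu m mC hC.2 CB) (eq_bigr (fun c => (r c)%:E)).
  by rewrite sumEFin.
move=> c _; rewrite fineK// ge0_fin_numE//; exact: (hC.1 c).2.
Qed.

(* y is the average of x over the classes, and arbitrary on null classes *)
Variables (x : 'I_L -> X) (y : 'I_M -> X).
Hypothesis xy : forall m, s m *: y m = \sum_(c < L | sigma c == Some m) r c *: x c.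

(* the compensated integrals of x and y, as functions of the counts *)
Let T (a : {ffun 'I_L -> nat}) : X := \sum_(c < L) ((a c)%:R - r c) *: x c.
Let S (k : {ffun 'I_M -> nat}) : X := \sum_(m < M) ((k m)%:R - s m) *: y m.

Section fibre.
Variable k : {ffun 'I_M -> nat}.

Let ind (a : {ffun 'I_L -> nat}) : bool := push sigma a == k.
(* the probability that the counts of the classes are k after a point has been
   added to C c *)
Let q (c : 'I_L) : \bar R := (\int[P]_w (ind (add_unit (kappa w) c))%:R%:E)%E.
Let pr : \bar R := (\int[P]_w (ind (kappa w))%:R%:E)%E.

Let mk d0 (Z : measurableType d0) (g : {ffun 'I_L -> nat} -> Z) :
  measurable_fun setT (fun w => g (kappa w)).
Proof. exact: (discrete_measurable g dk). Qed.

Let prob_fin (b : {ffun 'I_L -> nat} -> bool) :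
  (\int[P]_w (b (kappa w))%:R%:E)%E \is a fin_num.
Proof.
rewrite ge0_fin_numE; last by apply: integral_ge0 => w _; rewrite lee_fin.
apply: (@le_lt_trans _ _ (\int[P]_w (cst 1%E w))%E).
  apply: ge0_le_integral => //.
  - exact: (@mk _ _ (fun a => (b a)%:R%:E)).
  - by move=> w _; rewrite lee_fin; case: (b _).
by rewrite integral_cst//= mul1e probability_setT ltry.
Qed.

Let qfin c : q c \is a fin_num.
Proof. exact: (prob_fin (fun a => ind (add_unit a c))). Qed.

Let meckeq c : (\int[P]_w ((kappa w c)%:R * (ind (kappa w))%:R)%:E = (r c)%:E * q c)%E.
Proof.
by rewrite /q (mecke prmN hC c (g := fun a => (ind a)%:R%:E)).
Qed.

Let qNone c : sigma c = None -> q c = pr.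
Proof.
move=> sc; apply: eq_integral => w _.
by rewrite /ind push_add_unit sc.
Qed.

Let qSome c c' m : sigma c = Some m -> sigma c' = Some m -> q c = q c'.
Proof.
move=> sc sc'; apply: eq_integral => w _.
by rewrite /ind !push_add_unit sc sc'.
Qed.

Let sum_q m : (\sum_(c < L | sigma c == Some m) (r c)%:E * q c = (k m)%:R%:E * pr)%E.
Proof.
rewrite (eq_bigr
  (fun c => \int[P]_w ((kappa w c)%:R * (ind (kappa w))%:R)%:E)%E); last first.
  by move=> c _; rewrite meckeq.
rewrite -big_filter -ge0_integral_sum//; last first.
  by move=> c; exact: (@mk _ _ (fun a => ((a c)%:R * (ind a)%:R)%:E)).
rewrite /pr -ge0_integralZl//; last first.
  exact: (@mk _ _ (fun a => (ind a)%:R%:E)).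
apply: eq_integral => w _; rewrite big_filter sumEFin -EFinM; congr EFin.
rewrite -mulr_suml /ind; case: eqP => [<-|_]; last by rewrite !mulr0.
by rewrite ffunE natr_sum.
Qed.

Let zeta (c : 'I_L) (a : {ffun 'I_L -> nat}) : R := (ind a)%:R * ((a c)%:R - r c).

Let int_prod c : P.-integrable setT (fun w => ((kappa w c)%:R * (ind (kappa w))%:R)%:E).
Proof.
apply/integrableP; split; first exact: (@mk _ _ (fun a => ((a c)%:R * (ind a)%:R)%:E)).
rewrite (eq_integral (fun w => ((kappa w c)%:R * (ind (kappa w))%:R)%:E)); last first.
  by move=> w _; rewrite gee0_abs// lee_fin mulr_ge0.
by rewrite meckeq -[q c]fineK// -EFinM ltry.
Qed.

Let int_ind c : P.-integrable setT (fun w => (r c * (ind (kappa w))%:R)%:E).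
Proof.
apply/integrableP; split; first exact: (@mk _ _ (fun a => (r c * (ind a)%:R)%:E)).
rewrite (eq_integral (fun w => (r c)%:E * (ind (kappa w))%:R%:E)%E); last first.
  by move=> w _; rewrite gee0_abs// lee_fin mulr_ge0.
rewrite ge0_integralZl//; last 2 first.
- exact: (@mk _ _ (fun a => (ind a)%:R%:E)).
- by rewrite lee_fin.
by rewrite -/pr -[pr]fineK ?(prob_fin ind)// -EFinM ltry.
Qed.

Let zetaE c w : (zeta c (kappa w))%:E =
  (((kappa w c)%:R * (ind (kappa w))%:R)%:E - (r c * (ind (kappa w))%:R)%:E)%E.
Proof. by rewrite /zeta -EFinB mulrC mulrBl. Qed.

Let izeta c : P.-integrable setT (fun w => (zeta c (kappa w))%:E).
Proof.
rewrite (_ : (fun w => _) = (fun w => ((kappa w c)%:R * (ind (kappa w))%:R)%:E) \-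
  (fun w => (r c * (ind (kappa w))%:R)%:E))%E; last exact/funext/zetaE.
exact: integrableB.
Qed.

Let int_zeta c : fine (\int[P]_w (zeta c (kappa w))%:E)%E = r c * (fine (q c) - fine pr).
Proof.
under eq_integral do rewrite zetaE.
rewrite integralB// meckeq.
rewrite (eq_integral (fun w => (r c)%:E * (ind (kappa w))%:R%:E)%E); last first.
  by move=> w _; rewrite EFinM.
rewrite ge0_integralZl//; last 2 first.
- exact: (@mk _ _ (fun a => (ind a)%:R%:E)).
- by rewrite lee_fin.
rewrite -/pr -[q c]fineK// -[pr]fineK ?(prob_fin ind)//.
by rewrite -!EFinM -EFinB /= mulrBr.
Qed.

(* conditionally on the counts of the classes, the compensated integral of x has
   mean S k *)
Let mean_fibre :
  \sum_(c < L) fine (\int[P]_w (zeta c (kappa w))%:E)%E *: x c = fine pr *: S k.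
Proof.
rewrite (eq_bigr (fun c => (r c * (fine (q c) - fine pr)) *: x c)); last first.
  by move=> c _; rewrite int_zeta.
rewrite (sum_classes (sigma := sigma)); last first.
  by move=> c sc; rewrite qNone// subrr mulr0 scale0r.
rewrite /S scaler_sumr; apply: eq_bigr => m _.
pose Q := if [pick c | sigma c == Some m] is Some c then fine (q c) else 0.
have QE c : sigma c == Some m -> fine (q c) = Q.
  rewrite /Q => /eqP sc; case: pickP => [c' /eqP sc'|/(_ c)]; last by rewrite sc eqxx.
  by rewrite (qSome sc sc').
have sQ : s m * Q = (k m)%:R * fine pr.
  apply/EFin_inj; rewrite [in RHS]EFinM fineK ?(prob_fin ind)// -sum_q.
  rewrite fine_measure_refines mulr_suml -sumEFin; apply: eq_bigr => c sc.
  by rewrite -(QE _ sc) EFinM (fineK (qfin c)).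
rewrite (eq_bigr (fun c => (Q - fine pr) *: (r c *: x c))); last first.
  by move=> c sc; rewrite scalerA mulrC QE.
rewrite -scaler_sumr -xy !scalerA; congr (_ *: _).
by rewrite mulrBl mulrBr [Q * _]mulrC sQ [fine pr * _%:R]mulrC.
Qed.

Let jensen_fibre : ((fine pr * `|S k|)%:E <=
  \int[P]_w (if push sigma (kappa w) == k then `|T (kappa w)|%:E else 0))%E.
Proof.
have := norm_integral_le x dk izeta.
rewrite mean_fibre normrZ ger0_norm; last first.
  by apply: fine_ge0; apply: integral_ge0 => w _; rewrite lee_fin.
move=> /le_trans; apply; rewrite le_eqVlt; apply/orP; left; apply/eqP.
apply: eq_integral => w _; rewrite /zeta /ind; case: eqP => _ /=.
  by congr (`| _ |%:E); apply: eq_bigr => c _; rewrite mul1r.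
by rewrite big1 ?normr0// => c _; rewrite mul0r scale0r.
Qed.

(** Jensen's inequality for the power p follows from the inequality for the norm,
    by integration of the tangent inequality at the conditional mean. *)
Lemma jensen_fibre_pow (p : R) : 1 < p ->
  (\int[P]_w (if push sigma (kappa w) == k
              then (`|S (push sigma (kappa w))| `^ p)%:E else 0) <=
  \int[P]_w (if push sigma (kappa w) == k then (`|T (kappa w)| `^ p)%:E else 0))%E.
Proof.
move=> p1.
set t := fun a => `|T a|; set u := `|S k|.
have u0 : 0 <= u by exact: normr_ge0.
set J := (X in (_ <= X)%E).
have q0 : 0 <= p - 1 by lra.
have -> : (\int[P]_w (if push sigma (kappa w) == k
                      then (`|S (push sigma (kappa w))| `^ p)%:E else 0) =
    (u `^ p)%:E * pr)%E.
  rewrite /pr -ge0_integralZl//; last 2 first.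
  - exact: (@mk _ _ (fun a => (ind a)%:R%:E)).
  - by rewrite lee_fin powR_ge0.
  apply: eq_integral => w _; rewrite /ind; case: eqP => [->|_]; first by rewrite mule1.
  by rewrite mule0.
have H : ((p * u `^ (p - 1))%:E *
      (\int[P]_w (if push sigma (kappa w) == k then (t (kappa w))%:E else 0)) <=
    J + ((p - 1) * u `^ p)%:E * pr)%E.
  rewrite -ge0_integralZl//; last 3 first.
  - exact: (@mk _ _ (fun a => if push sigma a == k then (t a)%:E else 0%E)).
  - by move=> w _; case: ifP; rewrite // lee_fin normr_ge0.
  - by rewrite lee_fin mulr_ge0 ?powR_ge0//; lra.
  rewrite /pr -ge0_integralZl//; last 2 first.
  - exact: (@mk _ _ (fun a => (ind a)%:R%:E)).
  - by rewrite lee_fin mulr_ge0 ?powR_ge0.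
  rewrite /J -ge0_integralD//; last 4 first.
  - by move=> w _; case: ifP; rewrite // lee_fin powR_ge0.
  - exact: (@mk _ _ (fun a => if push sigma a == k then (t a `^ p)%:E else 0%E)).
  - by move=> w _; rewrite lee_fin mulr_ge0// mulr_ge0 ?powR_ge0.
  - exact: (@mk _ _ (fun a => (((p - 1) * u `^ p)%:E * (ind a)%:R%:E)%E)).
  apply: ge0_le_integral => //.
  - move=> w _; rewrite mule_ge0//; first by rewrite lee_fin mulr_ge0 ?powR_ge0//; lra.
    by case: ifP; rewrite // lee_fin normr_ge0.
  - exact: (@mk _ _ (fun a =>
      ((p * u `^ (p - 1))%:E * (if push sigma a == k then (t a)%:E else 0))%E)).
  - exact: (@mk _ _ (fun a => ((if push sigma a == k then (t a `^ p)%:E else 0) +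
      ((p - 1) * u `^ p)%:E * (ind a)%:R%:E)%E)).
  - move=> w _; rewrite /ind; case: ifP => _; last by rewrite !mule0 adde0.
    by rewrite mule1 -EFinM -EFinD lee_fin powR_tangent// normr_ge0.
have pu0 : 0 <= p * u `^ (p - 1) by rewrite mulr_ge0 ?powR_ge0//; lra.
have := lee_wpmul2l (x := (p * u `^ (p - 1))%:E) pu0 jensen_fibre.
move=> /le_trans/(_ H) {}H; move: H.
rewrite -[pr]fineK ?(prob_fin ind)// -!EFinM.
case: J => [j| |]; last 2 first.
- by move=> _; rewrite leey.
- by rewrite addNye leeNy_eq.
rewrite -EFinD !lee_fin -/u => H.
have := powR_pred p1 u0.
set v := u `^ (p - 1) in H *; set z := u `^ p in H * => vz.
have : p * v * (fine pr * u) = p * (z * fine pr) by rewrite -vz; ring.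
move: H => /[swap] -> H; lra.
Qed.

End fibre.

(** Averaging over the classes of a coarser family does not increase the moments
    of the compensated integral. *)
Lemma compensated_contraction (p : R) : 1 < p ->
  (Lp_norm P p (compensated_integral mu N B y) <=
   Lp_norm P p (compensated_integral mu N C x))%E.
Proof.
move=> p1; apply: le_Lp_norm_pow; first by lra.
have mk d0 (Z : measurableType d0) (g : {ffun 'I_L -> nat} -> Z) :
  measurable_fun setT (fun w => g (kappa w)) by exact: (discrete_measurable g dk).
have dkB : discrete (counts N B) by exact: (discrete_counts prmN).
have TE w : compensated_integral mu N C x w = T (kappa w).
  apply: eq_bigr => c _; congr (_ *: _).
  by rewrite /compensated (fine_count prmN)// ffunE.
have SE w : compensated_integral mu N B y w = S (counts N B w).
  apply: eq_bigr => m _; congr (_ *: _).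
  by rewrite /compensated (fine_count prmN)// ffunE.
rewrite (ae_eq_integral (fun w => (`|S (push sigma (kappa w))| `^ p)%:E))//; last 3 first.
- rewrite (_ : (fun w => _) = (fun w => (`|S (counts N B w)| `^ p)%:E)).
    exact: (discrete_measurable (fun b => (`|S b| `^ p)%:E) dkB).
  by apply/funext => w; rewrite SE.
- exact: (mk _ _ (fun a => (`|S (push sigma a)| `^ p)%:E)).
- have := ae_all_finite prmN hC; apply: filterS => w fw _.
  by rewrite SE counts_refines.
under [X in (_ <= X)%E]eq_integral do rewrite TE.
apply: (@le_integral_fibres _ _ _ _ _ (push sigma \o kappa)).
- exact: discrete_comp.
- exact: (mk _ _ (fun a => (`|S (push sigma a)| `^ p)%:E)).
- exact: (mk _ _ (fun a => (`|T a| `^ p)%:E)).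
- by move=> w; rewrite lee_fin powR_ge0.
- by move=> w; rewrite lee_fin powR_ge0.
- by move=> k; exact: jensen_fibre_pow.
Qed.

End classes.
End nu_norm.
(** * The completion of the simple functions *)

Section nu_completion_theory.
Context {d d' : measure_display} {Omega : measurableType d}
  {E : measurableType d'} {R : realType}.
Variables (P : probability Omega R) (mu : {sigma_finite_measure set E -> \bar R}).
Variable N : R.-ker Omega ~> E.
Hypothesis prmN : poisson_random_measure P mu N.
Context {X V : completeNormedModType R}.
Variables (p : R) (iota : (E -> X) -> V).
Hypothesis p1 : 1 < p.
Hypothesis nuV : nu_completion P mu N p iota.

Section one_family.
Variables (M : nat) (B : 'I_M -> set E).
Hypothesis hB : finite_disjoint mu B.

Let simpleB (x : 'I_M -> X) : simple_functions mu (step B x).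
Proof. by exists M, B, x. Qed.

Lemma iota_step_lin (a : R) (x y : 'I_M -> X) :
  iota (step B (fun m => a *: x m + y m)) = a *: iota (step B x) + iota (step B y).
Proof.
rewrite -(nu_linear nuV)//; congr iota; apply/funext => e.
rewrite /step !fctE scaler_sumr -big_split/=; apply: eq_bigr => m _.
by rewrite scalerDr !scalerA mulrC.
Qed.

Lemma iota_step0 : iota (step B (fun=> 0)) = 0.
Proof.
have := iota_step_lin 1 (fun=> 0) (fun=> 0).
have -> : (fun m : 'I_M => 1 *: (0 : X) + 0) = fun=> 0.
  by apply/funext => m; rewrite scaler0 addr0.
rewrite scale1r.
by move/eqP; rewrite -subr_eq subrr eq_sym => /eqP.
Qed.

Lemma iota_stepD (x y : 'I_M -> X) :
  iota (step B (fun m => x m + y m)) = iota (step B x) + iota (step B y).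
Proof.
rewrite -[X in _ = X + _]scale1r -iota_step_lin; congr (iota (step B _)).
by apply/funext => m; rewrite scale1r.
Qed.

Lemma iota_stepZ (a : R) (x : 'I_M -> X) :
  iota (step B (fun m => a *: x m)) = a *: iota (step B x).
Proof.
rewrite -[RHS]addr0 -iota_step0 -iota_step_lin; congr (iota (step B _)).
by apply/funext => m; rewrite addr0.
Qed.

Lemma iota_stepB (x y : 'I_M -> X) :
  iota (step B (fun m => x m - y m)) = iota (step B x) - iota (step B y).
Proof.
rewrite iota_stepD; congr (_ + _); rewrite -[RHS]scaleN1r -iota_stepZ.
by congr (iota (step B _)); apply/funext => m; rewrite scaleN1r.
Qed.

Lemma iota_step_sum (I : Type) (l : seq I) (x : I -> 'I_M -> X) :
  iota (step B (fun m => \sum_(i <- l) x i m)) = \sum_(i <- l) iota (step B (x i)).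
Proof.
elim: l => [|i l IHl].
  rewrite big_nil -iota_step0; congr (iota (step B _)).
  by apply/funext => m; rewrite big_nil.
rewrite big_cons -IHl -iota_stepD; congr (iota (step B _)).
by apply/funext => m; rewrite big_cons.
Qed.

Let single (m : 'I_M) (z : X) : 'I_M -> X := fun l => if l == m then z else 0.

(* the norm of 1_(B m) z depends on z through its norm only *)
Let norm_single (m : 'I_M) (z z' : X) : `|z| = `|z'| ->
  `|iota (step B (single m z))| = `|iota (step B (single m z'))|.
Proof.
move=> zz'; apply/EFin_inj; rewrite !(nu_isometry nuV _ hB).
have SE w u : compensated_integral mu N B (single m u) w = compensated mu N (B m) w *: u.
  rewrite /compensated_integral (bigD1 m)//= big1 ?addr0 /single ?eqxx//.
  by move=> l /negbTE ->; rewrite scaler0.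
by rewrite /Lp_norm; congr Lnorm; apply/funext => w; rewrite !SE !normrZ zz'.
Qed.

(** For a fixed family, the norm of a simple function is controlled by the norms
    of its values. *)
Lemma iota_step_bound : exists2 K : 'I_M -> R, (forall m, 0 <= K m) &
  forall x, `|iota (step B x)| <= \sum_(m < M) K m * `|x m|.
Proof.
have [[z0 z00]|X0] := pselect (exists z0 : X, z0 != 0); last first.
  exists (fun=> 0) => // x; rewrite (_ : x = fun=> 0) ?iota_step0 ?normr0 ?sumr_ge0//.
  apply/funext => m; apply/eqP/negPn/negP => xm; apply: X0.
  by exists (x m).
exists (fun m => `|iota (step B (single m z0))| / `|z0|).
  by move=> m; rewrite divr_ge0.
move=> x; rewrite (_ : x = fun l => \sum_(m < M) single m (x m) l); last first.
  apply/funext => l; rewrite /single (bigD1 l)//= eqxx big1 ?addr0//.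
  by move=> m; rewrite eq_sym => /negbTE ->.
rewrite iota_step_sum (le_trans (ler_norm_sum _ _ _))//.
apply: ler_sum => m _; rewrite (_ : \sum_(i < M) single i (x i) m = x m); last first.
  rewrite /single (bigD1 m)//= eqxx big1 ?addr0//.
  by move=> l; rewrite eq_sym => /negbTE ->.
have z0n : `|z0| != 0 by rewrite normr_eq0.
rewrite (norm_single m (z' := (`|x m| / `|z0|) *: z0)); last first.
  by rewrite normrZ normf_div !normr_id divfK.
rewrite (_ : single m _ = fun l => (`|x m| / `|z0|) *: single m z0 l); last first.
  by apply/funext => l; rewrite /single; case: ifP; rewrite // scaler0.
rewrite iota_stepZ normrZ normf_div !normr_id le_eqVlt; apply/orP; left.
by apply/eqP; ring.
Qed.

End one_family.

(** Averaging a simple function over the sets of a coarser family does not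
    increase its norm; when [B m] is a null set, [y m] may be any vector. *)
Lemma iota_step_contraction (M L : nat) (C : 'I_L -> set E) (B : 'I_M -> set E)
    (sigma : 'I_L -> option 'I_M) (x : 'I_L -> X) (y : 'I_M -> X) :
  finite_disjoint mu C -> finite_disjoint mu B -> refines C sigma B ->
  (forall m, fine (mu (B m)) *: y m =
     \sum_(c < L | sigma c == Some m) fine (mu (C c)) *: x c) ->
  `|iota (step B y)| <= `|iota (step C x)|.
Proof.
move=> hC hB CB xy; rewrite -lee_fin !(nu_isometry nuV)//.
exact: (compensated_contraction prmN hC hB CB).
Qed.

End nu_completion_theory.
(** * Strongly measurable functions and their L^1 and L^p norms *)

Section strong_measurability.
Context {d : measure_display} {Omega : measurableType d} {R : realType}.
Context {V : normedModType R}.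

Lemma bochner_simple_preimage (s : Omega -> V) (Y : set V) :
  bochner_simple s -> measurable (s @^-1` Y).
Proof.
move=> [fs ms]; have -> : s @^-1` Y = \bigcup_(v in range s `&` Y) (s @^-1` [set v]).
  apply/seteqP; split => [w Yw|w [v [_ Yv] /= ->]//].
  by exists (s w) => //; split => //; exists w.
by apply: fin_bigcup_measurable => //; exact: finite_setIl.
Qed.

Lemma bochner_simpleB (s t : Omega -> V) :
  bochner_simple s -> bochner_simple t -> bochner_simple (fun w => s w - t w).
Proof.
move=> hs ht; split.
  apply: (@sub_finite_set _ _ ((fun z : V * V => z.1 - z.2) @` (range s `*` range t))).
    move=> _ [w _ <-]; exists (s w, t w) => //=.
    by split => /=; exists w.
  by apply: finite_image; apply: finite_setX; [exact: hs.1|exact: ht.1].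
move=> v.
have -> : (fun w => s w - t w) @^-1` [set v] =
    \bigcup_(u in range t) ((s @^-1` [set v + u]) `&` (t @^-1` [set u])).
  apply/seteqP; split => [w /= <-|w [u _ [/= -> ->]]]; last by rewrite addrK.
  by exists (t w); [exists w | split => //=; rewrite subrK].
apply: fin_bigcup_measurable => [|u _]; first exact: ht.1.
by apply: measurableI; exact: bochner_simple_preimage.
Qed.

Lemma strongly_measurableB (F G : Omega -> V) :
  strongly_measurable F -> strongly_measurable G ->
  strongly_measurable (fun w => F w - G w).
Proof.
move=> [s [hs sF]] [t [ht tG]]; exists (fun n w => s n w - t n w); split.
  by move=> n; exact: bochner_simpleB.
by move=> w; exact: cvgB.
Qed.

Lemma strongly_measurable_norm (F : Omega -> V) :
  strongly_measurable F -> measurable_fun setT (fun w => `|F w|).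
Proof.
move=> [s [hs sF]].
apply: (@measurable_fun_cvg _ _ _ _ (fun n w => `|s n w|)).
  move=> n _ Y mY; rewrite setTI.
  exact: (@bochner_simple_preimage (s n) [set v | Y `|v|]).
by move=> w _; apply: cvg_norm.
Qed.

End strong_measurability.

Section L1.
Context {d : measure_display} {Omega : measurableType d} {R : realType}.
Variable P : probability Omega R.
Context {V : normedModType R}.

(** The norm of L^1; on a probability space, it is at most the norm of L^p. *)
Definition L1_norm (F : Omega -> V) : \bar R := (\int[P]_w `|F w|%:E)%E.

Lemma L1_norm_ge0 (F : Omega -> V) : (0 <= L1_norm F)%E.
Proof. by apply: integral_ge0 => w _; rewrite lee_fin. Qed.

Lemma L1_le_Lp (p : R) (F : Omega -> V) : 1 < p -> strongly_measurable F ->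
  (L1_norm F <= Lp_norm P p F)%E.
Proof.
move=> p1 sF; have p0 : 0 < p by lra.
have q0 : 0 < p - 1 by lra.
have mF := strongly_measurable_norm sF.
have := @hoelder _ _ _ P (fun w => `|F w|) (cst 1) p (p / (p - 1)) mF
  (measurable_cst _) p0 (divr_gt0 p0 q0).
rewrite (_ : EFin \o cst 1 = cst 1%E)//.
rewrite (_ : Lnorm P _ (cst 1%E) = 1%E) ?mule1; last first.
  rewrite Lnorm_cst1 -[RHS](poweR1r (p / (p - 1))^-1); congr (_ `^ _)%E.
  exact: probability_setT.
move=> h; apply: le_trans (h _).
  rewrite Lnorm1; apply: ge0_le_integral => //.
  - exact: measurableT_comp.
  - do 2 apply: measurableT_comp => //.
    by apply: measurable_funM.
  - by move=> w _; rewrite /= mulr1 normr_id.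
by field; rewrite !gt_eqF.
Qed.

Lemma Lp_normB (p : R) (F G : Omega -> V) : 1 < p ->
  strongly_measurable F -> strongly_measurable G ->
  (Lp_norm P p (fun w => F w - G w)%R <= Lp_norm P p F + Lp_norm P p G)%E.
Proof.
move=> p1 sF sG; have p0 : 0 < p by lra.
have mF := strongly_measurable_norm sF.
have mG := strongly_measurable_norm sG.
have mFG := strongly_measurable_norm (strongly_measurableB sF sG).
apply: le_trans
  (@minkowski_EFin _ _ _ P (fun w => `|F w|) (fun w => `|G w|) p mF mG (ltW p1)).
rewrite /Lp_norm !Lnorm.unlock; apply: gt0_ler_poweR.
- by rewrite invr_ge0 ltW.
- by rewrite in_itv/= leey andbT integral_ge0// => w _; rewrite lee_fin powR_ge0.
- by rewrite in_itv/= leey andbT integral_ge0// => w _; rewrite lee_fin powR_ge0.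
apply: ge0_le_integral => //.
- by move=> w _; rewrite lee_fin powR_ge0.
- apply: (measurableT_comp (measurable_poweR p)) => //.
  by do 2 apply: measurableT_comp => //.
- apply: (measurableT_comp (measurable_poweR p)) => //.
  by do 2 apply: measurableT_comp => //; exact: measurable_funD.
- move=> w _; rewrite lee_fin; apply: ge0_ler_powR; rewrite ?nnegrE//; first exact: ltW.
  by rewrite normr_id ger0_norm ?addr_ge0// ler_normB.
Qed.

Lemma cvg_LpB (p : R) (Fn Gn : nat -> Omega -> V) (F G : Omega -> V) : 1 < p ->
  (forall n, in_Lp P p (Fn n)) -> in_Lp P p F ->
  (forall n, in_Lp P p (Gn n)) -> in_Lp P p G ->
  cvg_Lp P p Fn F -> cvg_Lp P p Gn G ->
  cvg_Lp P p (fun n w => Fn n w - Gn n w) (fun w => F w - G w).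
Proof.
move=> p1 hFn hF hGn hG FnF GnG.
have FG : (Lp_norm P p (fun w => Fn n w - F w)%R +
  Lp_norm P p (fun w => Gn n w - G w)%R)%E @[n --> \oo] --> 0%E.
  by rewrite -[0%E]adde0; apply: cvgeD.
apply: (squeeze_cvge _ (cvg_cst 0%E) FG); apply: nearW => n.
rewrite Lnorm_ge0/=.
have -> : (fun w => Fn n w - Gn n w - (F w - G w))%R =
    (fun w => (Fn n w - F w) - (Gn n w - G w))%R.
  by apply/funext => w; rewrite !opprD !opprK addrACA.
apply: Lp_normB => //; apply: strongly_measurableB.
- by case: (hFn n).
- by case: hF.
- by case: (hGn n).
- by case: hG.
Qed.

End L1.
(** * Cylindrical functions and their derivatives *)

Section malliavin.
Context {d d' : measure_display} {Omega : measurableType d}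
  {E : measurableType d'} {R : realType}.
Variables (P : probability Omega R) (mu : {sigma_finite_measure set E -> \bar R}).
Variable N : R.-ker Omega ~> E.
Hypothesis prmN : poisson_random_measure P mu N.
Context {X V : completeNormedModType R}.
Variables (p : R) (iota : (E -> X) -> V).
Hypothesis p1 : 1 < p.
Hypothesis nuV : nu_completion P mu N p iota.

(** The increments of a function of the counts when a point is added. *)
Definition increment (M : nat) (phi : {ffun 'I_M -> nat} -> X)
  (a : {ffun 'I_M -> nat}) (m : 'I_M) : X := phi (add_unit a m) - phi a.

(** [F] is the cylindrical function [phi (N B_1, ..., N B_M)], with [phi]
    vector-valued, and [DF] is its Malliavin derivative. *)
Definition represented (M : nat) (B : 'I_M -> set E)
    (phi : {ffun 'I_M -> nat} -> X) (F : Omega -> X) (DF : Omega -> V) : Prop :=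
  [/\ finite_disjoint mu B,
      {ae P, forall w, F w = phi (counts N B w)} &
      {ae P, forall w, DF w = iota (step B (increment phi (counts N B w)))}].

Lemma graph_represented (F : Omega -> X) (DF : Omega -> V) :
  malliavin_graph P mu N p iota F DF -> exists M B phi, @represented M B phi F DF.
Proof.
move=> [_ [_ [n [M [B [f [x [_ [hB [FE DFE]]]]]]]]]].
exists M, B, (fun a => \sum_(i < n) f i a *: x i); split => //.
apply: filterS DFE => w ->; congr iota; apply/funext => e.
rewrite /malliavin exchange_big; apply: eq_bigr => m _.
rewrite /increment -sumrB scaler_sumr; apply: eq_bigr => i _.
by rewrite -scalerBl !scalerA mulrC.
Qed.

Lemma represented_refines (M L : nat) (B : 'I_M -> set E) (C : 'I_L -> set E)
    (sigma : 'I_L -> option 'I_M) (phi : {ffun 'I_M -> nat} -> X)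
    (F : Omega -> X) (DF : Omega -> V) :
  finite_disjoint mu C -> refines C sigma B ->
  represented B phi F DF -> represented C (phi \o push sigma) F DF.
Proof.
move=> hC CB [hB FE DFE]; have fin := ae_all_finite prmN hC.
have mC c : measurable (C c) by exact: (hC.1 c).1.
split => //.
  by apply: filterS2 FE fin => w -> fw; rewrite (counts_refines prmN hC hB CB).
apply: filterS2 DFE fin => w -> fw; congr iota.
rewrite (counts_refines prmN hC hB CB)// (step_refines _ mC hC.2 CB); congr step.
apply/funext => c; rewrite /pull /increment /= push_add_unit.
by case: (sigma c) => //; rewrite subrr.
Qed.

Lemma representedB (M : nat) (B : 'I_M -> set E) (phi psi : {ffun 'I_M -> nat} -> X)
    (F H : Omega -> X) (DF DH : Omega -> V) :
  represented B phi F DF -> represented B psi H DH ->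
  represented B (fun a => phi a - psi a) (fun w => F w - H w) (fun w => DF w - DH w).
Proof.
move=> [hB FE DFE] [_ HE DHE]; split => //.
  by apply: filterS2 FE HE => w -> ->.
apply: filterS2 DFE DHE => w -> ->; rewrite -(iota_stepB nuV)//.
congr (iota (step B _)); apply/funext => m.
by rewrite /increment /= !opprD !opprK addrACA.
Qed.

(** The Malliavin derivative is linear. *)
Lemma ex_representedB (F H : Omega -> X) (DF DH : Omega -> V) :
  (exists M B phi, @represented M B phi F DF) ->
  (exists M B phi, @represented M B phi H DH) ->
  exists M B phi, @represented M B phi (fun w => F w - H w) (fun w => DF w - DH w).
Proof.
move=> [M [B [phi rF]]] [M' [B' [psi rH]]].
have [hB _ _] := rF; have [hB' _ _] := rH.
have [L [C [sigma [sigma' [hC CB CB']]]]] := common_refinement hB hB'.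
exists L, C, (fun a => phi (push sigma a) - psi (push sigma' a)).
apply: representedB; first exact: represented_refines CB rF.
exact: represented_refines CB' rH.
Qed.

Lemma add_unit_inj (M : nat) (m : 'I_M) : injective (fun a => add_unit a m).
Proof.
move=> a b /ffunP ab; apply/ffunP => l.
by have := ab l; rewrite !ffunE => /addIn.
Qed.

Section averages.
Variables (M L : nat) (C : 'I_L -> set E) (B : 'I_M -> set E).
Variable sigma : 'I_L -> option 'I_M.
Hypotheses (hC : finite_disjoint mu C) (hB : finite_disjoint mu B).
Hypothesis CB : refines C sigma B.
Variable k : {ffun 'I_M -> nat}.

Let r c := fine (mu (C c)).
Let s m := fine (mu (B m)).
Let kappa := counts N C.
Let r0 c : 0 <= r c. Proof. by rewrite fine_ge0. Qed.
Let s0 m : 0 <= s m. Proof. by rewrite fine_ge0. Qed.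
Let dk : discrete kappa.
Proof. by apply: (discrete_counts prmN) => c; exact: (hC.1 c).1. Qed.
Let mk d0 (Z : measurableType d0) (g : {ffun 'I_L -> nat} -> Z) :
  measurable_fun setT (fun w => g (kappa w)).
Proof. exact: (discrete_measurable g dk). Qed.

Let on_k (w : Omega) (z : R) : \bar R :=
  if push sigma (kappa w) == k then z%:E else 0%E.

(** On the event that the counts of the classes are [k], the average over the
    class [m] of a function, after the addition of a point, is controlled by its
    integral: Mecke's formula introduces the number of points in the class after
    the addition, and this number is [(k m).+1]. *)
Lemma integral_added_le (m : 'I_M) (h : {ffun 'I_L -> nat} -> R) :
  (forall a, 0 <= h a) ->
  (\sum_(c < L | sigma c == Some m) (r c)%:E *
     \int[P]_w on_k w (h (add_unit (kappa w) c) + h (kappa w))%R <=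
   ((k m).+1%:R + s m)%:E * \int[P]_w (h (kappa w))%:E)%E.
Proof.
move=> h0.
have onk0 w z : 0 <= z -> (0 <= on_k w z)%E.
  by move=> z0; rewrite /on_k; case: ifP; rewrite // lee_fin.
have monk (g : {ffun 'I_L -> nat} -> R) :
    measurable_fun setT (fun w => on_k w (g (kappa w))).
  exact: (@mk _ _ (fun a => if push sigma a == k then (g a)%:E else 0%E)).
have onkD w z z' : on_k w (z + z') = (on_k w z + on_k w z')%E.
  by rewrite /on_k; case: ifP; rewrite ?adde0.
pose g a : \bar R := if push sigma a == add_unit k m then (h a)%:E else 0%E.
have g0 a : (0 <= g a)%E by rewrite /g; case: ifP; rewrite // lee_fin.
have mg : measurable_fun setT (fun w => g (kappa w)) by exact: mk.
have step c : sigma c == Some m -> ((r c)%:E *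
     \int[P]_w on_k w (h (add_unit (kappa w) c) + h (kappa w))%R =
   \int[P]_w ((kappa w c)%:R%:E * g (kappa w)) +
   (r c)%:E * \int[P]_w on_k w (h (kappa w)))%E.
  move=> /eqP sc; under eq_integral do rewrite onkD.
  rewrite ge0_integralD; [|exact: measurableT| | | |]; last 4 first.
  - by move=> w _; exact: onk0.
  - exact: (monk (fun a => h (add_unit a c))).
  - by move=> w _; exact: onk0.
  - exact: monk.
  rewrite ge0_muleDr; last 2 first.
  - by apply: integral_ge0 => w _; exact: onk0.
  - by apply: integral_ge0 => w _; exact: onk0.
  congr (_ + _)%E; rewrite -(mecke prmN hC c g0); congr (_ * _)%E.
  apply: eq_integral => w _.
  by rewrite /on_k /g push_add_unit sc (inj_eq (@add_unit_inj _ m)).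
rewrite (eq_bigr _ step) big_split/=.
rewrite EFinD ge0_muleDl; last 2 first.
- by rewrite lee_fin.
- by rewrite lee_fin.
apply: leeD.
  rewrite -big_filter -ge0_integral_sum//; last 2 first.
  - move=> c; exact: (@mk _ _ (fun a => ((a c)%:R%:E * g a)%E)).
  - by move=> c w _; rewrite mule_ge0.
  rewrite -ge0_integralZl; [|exact: measurableT|
    exact: (@mk _ _ (fun a => (h a)%:E))| |]; last 2 first.
  - by move=> w _; rewrite lee_fin.
  - by rewrite lee_fin.
  apply: ge0_le_integral => //.
  - by move=> w _; apply: sume_ge0 => c _; rewrite mule_ge0.
  - apply: emeasurable_sum => c; exact: (@mk _ _ (fun a => ((a c)%:R%:E * g a)%E)).
  - exact: (@mk _ _ (fun a => ((k m).+1%:R%:E * (h a)%:E)%E)).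
  - move=> w _; rewrite big_filter -ge0_sume_distrl; last by move=> c _; rewrite lee_fin.
    rewrite sumEFin /g; case: eqP => [kw|_]; last by rewrite mule0 mule_ge0 ?lee_fin.
    rewrite le_eqVlt; apply/orP; left; apply/eqP; congr (_%:E * _)%E.
    rewrite -natr_sum; congr (_%:R).
    by move/ffunP/(_ m): kw; rewrite !ffunE eqxx addn1.
rewrite -ge0_sume_distrl; last by move=> c _; rewrite lee_fin.
rewrite sumEFin -(fine_measure_refines hC CB m).
apply: lee_wpmul2l; first by rewrite lee_fin fine_ge0.
apply: ge0_le_integral => //.
- by move=> w _; exact: onk0.
- exact: (@mk _ _ (fun a => (h a)%:E)).
- by move=> w _; rewrite /on_k; case: ifP; rewrite // lee_fin.
Qed.

Variables (K : 'I_M -> R).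
Hypotheses (K0 : forall m, 0 <= K m).
Hypothesis KP : forall x, `|iota (step B x)| <= \sum_(m < M) K m * `|x m|.

(* the coefficients of the averages over the classes, weighted by the constants K *)
Let weight (c : 'I_L) : R := if sigma c is Some m then K m / s m * r c else 0.

Let weight0 c : 0 <= weight c.
Proof. by rewrite /weight; case: (sigma c) => // m; rewrite !mulr_ge0 ?invr_ge0. Qed.

Lemma integral_weight_le (h : {ffun 'I_L -> nat} -> R) : (forall a, 0 <= h a) ->
  (\int[P]_w on_k w
     (\sum_(c < L) weight c * (h (add_unit (kappa w) c) + h (kappa w)))%R <=
   (\sum_(m < M) K m / s m * ((k m).+1%:R + s m))%:E * \int[P]_w (h (kappa w))%:E)%E.
Proof.
move=> h0.
have H0 w c : 0 <= h (add_unit (kappa w) c) + h (kappa w) by rewrite addr_ge0.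
have onk0 w c : (0 <= on_k w (h (add_unit (kappa w) c) + h (kappa w)))%E.
  by rewrite /on_k; case: ifP; rewrite // lee_fin.
have -> : (\int[P]_w on_k w
      (\sum_(c < L) weight c * (h (add_unit (kappa w) c) + h (kappa w)))%R =
    \sum_(c < L) (weight c)%:E *
      \int[P]_w on_k w (h (add_unit (kappa w) c) + h (kappa w))%R)%E.
  rewrite (eq_bigr (fun c => \int[P]_w ((weight c)%:E *
    on_k w (h (add_unit (kappa w) c) + h (kappa w))%R))%E); last first.
    move=> c _; rewrite ge0_integralZl//.
    - exact: (@mk _ _ (fun a =>
        if push sigma a == k then (h (add_unit a c) + h a)%:E else 0%E)).
    - by rewrite lee_fin.
  rewrite -ge0_integral_sum//; last 2 first.
  - move=> c; exact: (@mk _ _ (fun a => ((weight c)%:E *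
      if push sigma a == k then (h (add_unit a c) + h a)%:E else 0)%E)).
  - by move=> c w _; rewrite mule_ge0// lee_fin.
  apply: eq_integral => w _; rewrite /on_k; case: ifP => _.
    by rewrite -sumEFin; apply: eq_bigr => c _; rewrite EFinM.
  by rewrite big1// => c _; rewrite mule0.
rewrite (sum_classes (sigma := sigma)); last by move=> c sc; rewrite /weight sc mul0e.
rewrite -sumEFin ge0_sume_distrl; last first.
  by move=> m _; rewrite lee_fin !mulr_ge0 ?invr_ge0 ?addr_ge0.
apply: lee_sum => m _.
rewrite (eq_bigr (fun c => (K m / s m)%:E * ((r c)%:E *
  \int[P]_w on_k w (h (add_unit (kappa w) c) + h (kappa w))%R))%E); last first.
  by move=> c /eqP sc; rewrite /weight sc EFinM muleA.
rewrite -ge0_sume_distrr; last first.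
  by move=> c _; rewrite mule_ge0 ?lee_fin// integral_ge0.
rewrite [in leRHS]EFinM -[leRHS]muleA; apply: lee_wpmul2l.
  by rewrite lee_fin mulr_ge0 ?invr_ge0.
exact: integral_added_le.
Qed.

(** The increments of [phi] on the coarse family are controlled by the averages
    over its classes of the increments of [psi] on the fine family. *)
Lemma increment_le (phi : {ffun 'I_M -> nat} -> X) (psi : {ffun 'I_L -> nat} -> X)
    (a : {ffun 'I_L -> nat}) :
  `|iota (step B (increment phi k))| <=
  `|iota (step B (increment phi k)) - iota (step C (increment psi a))| +
  \sum_(c < L) weight c * (`|psi (add_unit a c)| + `|psi a|).
Proof.
set y' := increment phi k; set g := increment psi a.
have mC c : measurable (C c) by exact: (hC.1 c).1.
pose G m := \sum_(c < L | sigma c == Some m) r c *: g c.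
have GE m : s m *: ((s m)^-1 *: G m) = G m.
  have [sm|sm] := eqVneq (s m) 0; last by rewrite scalerA divff// scale1r.
  rewrite sm scale0r /G big1// => c sc; suff -> : r c = 0 by rewrite scale0r.
  move: sm; rewrite /s (fine_measure_refines hC CB m) => sm.
  exact: (psumr_eq0P (fun c _ => r0 c) sm sc).
(* y is the average of the difference of the two derivatives; GE also covers the
   null classes, where the inverse of 0 is 0 *)
pose y m := y' m - (s m)^-1 *: G m.
have H1 : `|iota (step B y)| <= `|iota (step B y') - iota (step C g)|.
  rewrite (step_refines y' mC hC.2 CB) -(iota_stepB nuV)//.
  apply: (iota_step_contraction prmN p1 nuV hC hB CB) => m.
  rewrite scalerBr GE (fine_measure_refines hC CB m) scaler_suml -sumrB.
  by apply: eq_bigr => c /eqP sc; rewrite [RHS]scalerBr /pull sc.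
have y'E : iota (step B y') = iota (step B y) + iota (step B (fun m => (s m)^-1 *: G m)).
  rewrite -(iota_stepD nuV)//; congr (iota (step B _)).
  by apply/funext => m; rewrite subrK.
rewrite {1}y'E (le_trans (ler_normD _ _))// lerD//.
rewrite (le_trans (KP _))// [leRHS](sum_classes (sigma := sigma)); last first.
  by move=> c sc; rewrite /weight sc mul0r.
apply: ler_sum => m _; rewrite normrZ ger0_norm ?invr_ge0// mulrA.
rewrite (eq_bigr
  (fun c => K m / s m * (r c * (`|psi (add_unit a c)| + `|psi a|)))); last first.
  by move=> c /eqP sc; rewrite /weight sc mulrA.
rewrite -mulr_sumr ler_wpM2l// ?mulr_ge0 ?invr_ge0//.
rewrite (le_trans (ler_norm_sum _ _ _))//; apply: ler_sum => c _.
by rewrite normrZ ger0_norm// ler_wpM2l// ler_normB.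
Qed.

End averages.
End malliavin.
(** * Closability *)

Section closability.
Context {d d' : measure_display} {Omega : measurableType d}
  {E : measurableType d'} {R : realType}.
Variables (P : probability Omega R) (mu : {sigma_finite_measure set E -> \bar R}).
Variable N : R.-ker Omega ~> E.
Hypothesis prmN : poisson_random_measure P mu N.
Context {X V : completeNormedModType R}.
Variables (p : R) (iota : (E -> X) -> V).
Hypothesis p1 : 1 < p.
Hypothesis nuV : nu_completion P mu N p iota.

(** On the event that the counts of the family [B] are [k], the derivative of a
    function [F] of these counts is controlled by its distance to [DH] and by
    the size of [H], for all cylindrical [H], with a constant that does not
    depend on [H]. *)
Lemma derivative_fibre_le (M : nat) (B : 'I_M -> set E)
    (phi : {ffun 'I_M -> nat} -> X) (F : Omega -> X) (DF : Omega -> V)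
    (k : {ffun 'I_M -> nat}) :
  represented P mu N iota B phi F DF -> strongly_measurable DF ->
  exists2 K : R, 0 <= K & forall (H : Omega -> X) (DH : Omega -> V),
    strongly_measurable H -> strongly_measurable DH ->
    (exists M' B' psi, @represented _ _ _ _ _ P mu N _ _ iota M' B' psi H DH) ->
    (\int[P]_w (if counts N B w == k then `|DF w|%:E else 0) <=
     \int[P]_w (if counts N B w == k then `|DF w - DH w|%:E else 0) +
     K%:E * L1_norm P H)%E.
Proof.
move=> rF sDF; have [hB _ DFE] := rF.
have [Kb K0 KP] := iota_step_bound nuV hB.
exists (\sum_(m < M) Kb m / fine (mu (B m)) * ((k m).+1%:R + fine (mu (B m)))).
  by apply: sumr_ge0 => m _; rewrite !mulr_ge0 ?invr_ge0 ?addr_ge0 ?fine_ge0.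
move=> H DH sH sDH [M' [B' [psi' rH']]].
have [hB' _ _] := rH'.
have [L [C [sigma [sigma' [hC CB CB']]]]] := common_refinement hB hB'.
have [_ HE DHE] := represented_refines prmN hC CB' rH'.
set psi := psi' \o push sigma' in HE DHE.
have fin := ae_all_finite prmN hC.
have mB m : measurable (B m) by exact: (hB.1 m).1.
have mC c : measurable (C c) by exact: (hC.1 c).1.
have dk : discrete (counts N C) by exact: (discrete_counts prmN).
have dB : discrete (counts N B) by exact: (discrete_counts prmN).
have h0 a : 0 <= `|psi a| by [].
have HL : (\int[P]_w `|psi (counts N C w)|%:E = L1_norm P H)%E.
  apply: ae_eq_integral => //.
  - exact: (discrete_measurable (fun a => `|psi a|%:E) dk).
  - by apply: measurableT_comp => //; exact: strongly_measurable_norm.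
  - by apply: filterS HE => w ->.
pose W (a : {ffun 'I_L -> nat}) : R := \sum_(c < L)
  (if sigma c is Some m then Kb m / fine (mu (B m)) * fine (mu (C c)) else 0) *
  (`|psi (add_unit a c)| + `|psi a|).
have := integral_weight_le prmN hC CB k K0 h0; rewrite HL.
rewrite -/(W _) => HW; apply: le_trans (leeD (lexx _) HW).
have W0 a : 0 <= W a.
  apply: sumr_ge0 => c _; case: (sigma c) => [m|]; last by rewrite mul0r.
  by rewrite !mulr_ge0 ?invr_ge0 ?fine_ge0 ?addr_ge0.
have mD (G : Omega -> V) :
    strongly_measurable G -> measurable_fun setT (fun w => `|G w|%:E).
  by move=> sG; apply: measurableT_comp => //; exact: strongly_measurable_norm.
have mW : measurable_fun setT
    (fun w => if push sigma (counts N C w) == k then (W (counts N C w))%:E else 0%E).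
  exact: (discrete_measurable (fun a => if push sigma a == k then (W a)%:E else 0%E) dk).
rewrite -ge0_integralD; [|exact: measurableT| | | |exact: mW]; last 3 first.
- by move=> w _; case: ifP; rewrite // lee_fin.
- by apply: measurable_fibre_if => //; apply: mD; exact: strongly_measurableB.
- by move=> w _; case: ifP; rewrite // lee_fin W0.
apply: ae_ge0_le_integral => //.
- by move=> w _; case: ifP; rewrite // lee_fin.
- by apply: measurable_fibre_if => //; exact: mD.
- by move=> w _; apply: adde_ge0; case: ifP; rewrite // lee_fin ?W0.
- apply: emeasurable_funD => //.
  by apply: measurable_fibre_if => //; apply: mD; exact: strongly_measurableB.
apply: filterS3 DFE DHE fin => w -> -> fw _.
rewrite (counts_refines prmN hC hB CB fw); case: eqP => [->|_]; last by rewrite adde0.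
rewrite -EFinD lee_fin.
exact: (increment_le prmN p1 nuV hC hB CB k K0 KP phi psi).
Qed.

(** The core of closability: if cylindrical functions [H n] tend to 0 in L^1 and
    their derivatives [D n] tend to [G] in L^1, then [G] vanishes. *)
Lemma derivative_null (H : nat -> Omega -> X) (D : nat -> Omega -> V) (G : Omega -> V) :
  (forall n, strongly_measurable (H n)) -> (forall n, strongly_measurable (D n)) ->
  strongly_measurable G ->
  (forall n, exists M B phi,
     @represented _ _ _ _ _ P mu N _ _ iota M B phi (H n) (D n)) ->
  L1_norm P (H n) @[n --> \oo] --> 0%E ->
  L1_norm P (fun w => D n w - G w) @[n --> \oo] --> 0%E ->
  {ae P, forall w, G w = 0}.
Proof.
move=> sH sD sG rHD H0 D0.
have mE (F : Omega -> V) :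
    strongly_measurable F -> measurable_fun setT (fun w => `|F w|%:E).
  by move=> sF; apply: measurableT_comp => //; exact: strongly_measurable_norm.
have sDG n : strongly_measurable (fun w => D n w - G w) by exact: strongly_measurableB.
have bound n : (L1_norm P (D n) <= L1_norm P (fun w => D n w - G w)%R)%E.
  have [M [B [phi rn]]] := rHD n.
  have [hB _ _] := rn.
  have dB : discrete (counts N B).
    by apply: (discrete_counts prmN) => m; exact: (hB.1 m).1.
  apply: (le_integral_fibres dB) => //; [exact: mE|exact: mE|].
  move=> k; have [K K0 HK] := derivative_fibre_le k rn (sD n).
  set I := (X in (_ <= X)%E).
  have cvgI : (I + (L1_norm P (fun w => D j w - G w)%R + K%:E * L1_norm P (H j)))%E
      @[j --> \oo] --> I.
    rewrite -[X in _ --> X]adde0.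
    apply: cvgeD; [exact: fin_num_adde_defl|exact: cvg_cst|].
    rewrite -[X in _ --> X]adde0; apply: cvgeD => //.
    by rewrite -[X in _ --> X](mule0 K%:E); apply: cvgeZl.
  rewrite -(cvg_lim _ cvgI)//; apply: lime_ge; first by apply: cvgP cvgI.
  apply: nearW => j; apply: le_trans (HK _ _ (sH j) (sD j) (rHD j)) _.
  rewrite addeA; apply: leeD => //.
  rewrite /L1_norm /I -ge0_integralD; [|exact: measurableT| | | |]; last 4 first.
  - by move=> w _; case: ifP; rewrite // lee_fin.
  - by apply: measurable_fibre_if => //; exact: mE.
  - by move=> w _; rewrite lee_fin.
  - exact: mE.
  apply: ge0_le_integral => //.
  - by move=> w _; case: ifP; rewrite // lee_fin.
  - by apply: measurable_fibre_if => //; apply: mE; exact: strongly_measurableB.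
  - apply: emeasurable_funD; last exact: mE.
    by apply: measurable_fibre_if => //; exact: mE.
  - move=> w _; case: ifP => _; last by rewrite add0e lee_fin.
    rewrite -EFinD lee_fin [`|D j w - _|]distrC.
    by rewrite (le_trans _ (ler_normD _ _))// addrA subrK.
have G0 : L1_norm P G = 0%E.
  have cvg0 : (L1_norm P (fun w => D n w - G w)%R + L1_norm P (fun w => D n w - G w)%R)%E
      @[n --> \oo] --> 0%E.
    by rewrite -[X in _ --> X]adde0; apply: cvgeD.
  apply/eqP; rewrite eq_le L1_norm_ge0 andbT -(cvg_lim _ cvg0)//.
  apply: lime_ge; first by apply: cvgP cvg0.
  apply: nearW => n; apply: le_trans (leeD (bound n) (lexx _)).
  rewrite /L1_norm -ge0_integralD; [|exact: measurableT| | | |]; last 4 first.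
  - by move=> w _; rewrite lee_fin.
  - exact: mE.
  - by move=> w _; rewrite lee_fin.
  - exact: mE.
  apply: ge0_le_integral => //; [exact: mE|apply: emeasurable_funD; exact: mE|].
  move=> w _; rewrite -EFinD lee_fin -[`|D n w - _|]normrN.
  by rewrite (le_trans _ (ler_normD _ _))// opprB addrC subrK.
have := (ae_eq_integral_abs P measurableT (mE _ sG)).1.
rewrite (_ : (\int[P]_(w in _) _ = L1_norm P G)%E); last first.
  by apply: eq_integral => w _; rewrite gee0_abs// lee_fin.
move=> /(_ G0); apply: filterS => w /(_ I)[/eqP].
by rewrite normr_eq0 => /eqP.
Qed.

End closability.

Theorem theorem5p6 (d d' : measure_display) (Omega : measurableType d)
    (E : measurableType d') (R : realType) (P : probability Omega R)
    (mu : {sigma_finite_measure set E -> \bar R}) (N : R.-ker Omega ~> E)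
    (X : completeNormedModType R) (p : R)
    (V : completeNormedModType R) (iota : (E -> X) -> V) :
  poisson_random_measure P mu N ->
  1 < p ->
  nu_completion P mu N p iota ->
  closable P p (malliavin_graph P mu N p iota).
Proof.
move=> prmN p1 nuV F G1 G2.
move=> [LF [LG1 [F1 [D1 [T1 [F1F D1G]]]]]] [_ [LG2 [F2 [D2 [T2 [F2F D2G]]]]]].
have LF1 n : in_Lp P p (F1 n) by case: (T1 n).
have LF2 n : in_Lp P p (F2 n) by case: (T2 n).
have LD1 n : in_Lp P p (D1 n) by case: (T1 n) => _ [].
have LD2 n : in_Lp P p (D2 n) by case: (T2 n) => _ [].
have L1cvg (Y : normedModType R) (u : nat -> Omega -> Y) :
    (forall n, strongly_measurable (u n)) ->
    Lp_norm P p (u n) @[n --> \oo] --> 0%E -> L1_norm P (u n) @[n --> \oo] --> 0%E.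
  move=> su u0; apply: (squeeze_cvge _ (cvg_cst 0%E) u0); apply: nearW => n.
  by rewrite L1_norm_ge0 L1_le_Lp.
have sH n : strongly_measurable (fun w => F1 n w - F2 n w).
  by apply: strongly_measurableB; [case: (LF1 n)|case: (LF2 n)].
have sD n : strongly_measurable (fun w => D1 n w - D2 n w).
  by apply: strongly_measurableB; [case: (LD1 n)|case: (LD2 n)].
have sG : strongly_measurable (fun w => G1 w - G2 w).
  by apply: strongly_measurableB; [case: LG1|case: LG2].
have GG : {ae P, forall w, G1 w - G2 w = 0}.
  apply: (derivative_null prmN p1 nuV sH sD sG).
  - move=> n; apply: (ex_representedB prmN nuV); apply: graph_represented.
      exact: T1.
    exact: T2.
  - apply: L1cvg => //.
    have FF : (fun n => Lp_norm P p (fun w => F1 n w - F2 n w - (F w - F w))) =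
        (fun n => Lp_norm P p (fun w => F1 n w - F2 n w)).
      apply/funext => n; congr (Lp_norm P p).
      by apply/funext => w; rewrite subrr subr0.
    by have := cvg_LpB p1 LF1 LF LF2 LF F1F F2F; rewrite /cvg_Lp FF.
  - apply: L1cvg => [n|]; first exact: strongly_measurableB.
    exact: (cvg_LpB p1 LD1 LG1 LD2 LG2 D1G D2G).
by apply: filterS GG => w /eqP; rewrite subr_eq0 => /eqP.
Qed.
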